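(* Let $(T_n)$ be a sequence of fixed rooted trees, where $T_n$ has $n$ nodes, and let $$X_n=\frac{I(T_n)-\mathbb E[I(T_n)]}{\sqrt{\Upsilon_2(T_n)}}.$$ Assume that for all $k\ge1$, $$\frac{\Upsilon_{2k}(T_n)}{\Upsilon_2(T_n)^k}\to\zeta_{2k}\qquad(n\to\infty)$$ for some sequence $(\zeta_{2k})_{k\ge1}$. Then there exists a unique distribution $X$ with cumulants $$\varkappa_{2k-1}(X)=0,\qquad \varkappa_{2k}(X)=\frac{B_{2k}}{2k}\zeta_{2k},\qquad k\ge1,$$ such that $X_n$ converges in distribution to $X$ and, moreover, $\mathbb E[e^{tX_n}]\to\mathbb E[e^{tX}]<\infty$ for every $t\in\mathbb R$.
   Context: For nodes $u,v$ of a rooted tree, $u<v$ means that $u$ is a proper ancestor of $v$, and $u\le v$ means $u<v$ or $u=v$. For a rooted tree $T$ with node set $V$ and a bijection $\lambda:V\to\{1,\dots,|V|\}$ let $I(T,\lambda)=\sum_{u<v}\mathbf 1_{\lambda(u)>\lambda(v)}$; $I(T)$ is $I(T,\lambda)$ with $\lambda$ a uniformly random such bijection. For nodes $v_1,\dots,v_k$ (not necessarily distinct), $c(v_1,\dots,v_k)=|\{u\in V:u\le v_1,\dots,u\le v_k\}|$, and $\Upsilon_k(T)=\sum_{v_1,\dots,v_k}c(v_1,\dots,v_k)$, summed over all ordered $k$-tuples of nodes of $T$. $\varkappa_k(X)$ denotes the $k$-th cumulant of $X$. Bernoulli numbers $B_k$ are defined by $\sum_{k\ge0}B_kx^k/k!=x/(e^x-1)$.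 *)

(* Defs.v *)
From HB Require Import structures.
From mathcomp Require Import all_boot all_order all_algebra finmap ring lra zify.
From mathcomp Require Import all_classical all_reals all_analysis.

Set Implicit Arguments.
Unset Strict Implicit.
Unset Printing Implicit Defensive.

Import Order.TTheory GRing.Theory Num.Theory.
Import numFieldNormedType.Exports.

Local Open Scope classical_set_scope.
Local Open Scope ring_scope.

(* The parent of the root is the root itself (a dummy value); the last field
   says that iterating [parent] from any node eventually reaches the root, so
   that [parent] has no other cycle. *)
Record rooted_tree := RootedTree {
  node :> finType;
  root : node;
  parent : node -> node;
  parent_root : parent root = root;
  root_reachable : forall v, fconnect parent v root }.

Section TreeParameters.
Variable T : rooted_tree.

Definition ancestor (u v : T) : bool := fconnect (@parent T) v u.

Definition proper_ancestor (u v : T) : bool := (u != v) && ancestor u v.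

Definition common_ancestors k (v : {ffun 'I_k -> T}) : nat :=
  #|[pred u : T | [forall i, ancestor u (v i)]]|.

Definition Upsilon k : nat := (\sum_(v : {ffun 'I_k -> T}) common_ancestors v)%N.

(* Injective, hence bijective by cardinality.  The labels are 0, ..., |T|-1
   rather than 1, ..., |T|; only their relative order matters. *)
Record labelling := Labelling {
  label :> {ffun T -> 'I_#|T|};
  label_inj : injectiveb label }.

HB.instance Definition _ := [isSub for label].
HB.instance Definition _ := [Finite of labelling by <:].

Lemma enum_rank_injectiveb : injectiveb [ffun v : T => enum_rank v].
Proof. by apply/injectiveP => u v; rewrite !ffunE; exact: enum_rank_inj. Qed.

HB.instance Definition _ :=
  isPointed.Build labelling (Labelling enum_rank_injectiveb).

HB.instance Definition _ := @isMeasurable.Build default_measure_display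
  labelling discrete_measurable discrete_measurable0
  discrete_measurableC discrete_measurableU.

Definition inversions (l : labelling) : nat :=
  (\sum_(u : T) \sum_(v : T | proper_ancestor u v) (l v < l u))%N.

Variable R : realType.

(* Uniform distribution; the last argument of [mnormalize] is only used when
   the total mass is 0 or infinite, see [uniform_labelling1]. *)
Definition uniform_labelling : probability labelling R :=
  mnormalize (@counting labelling R) (dirac point).

Definition mean_inversions : R :=
  fine 'E_uniform_labelling[fun l => (inversions l)%:R].

Definition normalized_inversions (l : labelling) : R :=
  ((inversions l)%:R - mean_inversions) / Num.sqrt (Upsilon 2)%:R.

Lemma measurable_normalized_inversions :
  measurable_fun [set: labelling] normalized_inversions.
Proof. by []. Qed.

HB.instance Definition _ := isMeasurableFun.Build _ _ _ _
  normalized_inversions measurable_normalized_inversions.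

Lemma uniform_labelling1 (l : labelling) :
  uniform_labelling [set l] = (#|{: labelling}|%:R^-1)%:E.
Proof.
have cT : @counting labelling R [set: labelling] = #|{: labelling}|%:R%:E.
  rewrite /counting asboolT; last exact: finite_finset.
  rewrite (_ : fset_set _ = [fset x in enum {: labelling}]%fset).
    by rewrite card_fseq undup_id ?enum_uniq// -cardE.
  apply/fsetP => x; rewrite in_fset_set; last exact: finite_finset.
  by rewrite inE mem_enum; apply/idP; rewrite inE.
have c1 : @counting labelling R [set l] = 1%E.
  by rewrite /counting asboolT ?fset_set1 ?cardfs1//; exact: finite_set1.
have T0 : #|{: labelling}|%:R != 0 :> R.
  by rewrite pnatr_eq0 -lt0n; apply/card_gt0P; exists l.
rewrite /uniform_labelling /= /mnormalize /= cT eqe (negbTE T0) /= c1.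
by rewrite mul1e.
Qed.

End TreeParameters.

Section Bernoulli.
Variable R : realType.

(* B_k / k! for k < n, obtained by inverting the power series
   (e^x - 1) / x = \sum_j x^j / (j + 1)!; see [bernoulli_gf]. *)
Fixpoint bernoulli_coefs n : seq R :=
  if n is m.+1 then
    let b := bernoulli_coefs m in
    rcons b ((m == 0)%:R - \sum_(k < m) b`_k / (m - k).+1`!%:R)
  else [::].

Definition bernoulli n : R := n`!%:R * (bernoulli_coefs n.+1)`_n.

Lemma size_bernoulli_coefs n : size (bernoulli_coefs n) = n.
Proof. by elim: n => //= n IHn; rewrite size_rcons IHn. Qed.

Lemma nth_bernoulli_coefs n k : (k < n)%N ->
  (bernoulli_coefs n)`_k = bernoulli k / k`!%:R.
Proof.
have k0 : k`!%:R != 0 :> R by rewrite pnatr_eq0 -lt0n fact_gt0.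
rewrite /bernoulli mulrC mulKf//.
elim: n => // n IHn; rewrite ltnS leq_eqVlt => /predU1P[->//|kn].
by rewrite [LHS]/= nth_rcons size_bernoulli_coefs kn IHn.
Qed.

Lemma bernoulli_rec n :
  \sum_(k < n.+1) bernoulli k / k`!%:R / (n - k).+1`!%:R = (n == 0)%:R.
Proof.
rewrite big_ord_recr /= subnn divr1 -(nth_bernoulli_coefs (ltnSn n)) /=.
rewrite nth_rcons size_bernoulli_coefs ltnn eqxx addrC.
under eq_bigr => i _ do rewrite nth_bernoulli_coefs//.
by rewrite subrK.
Qed.

Lemma normr_bernoulli_le n : `|bernoulli n / n`!%:R| <= 1.
Proof.
elim/ltn_ind: n => n IHn.
rewrite -(nth_bernoulli_coefs (ltnSn n)) /= nth_rcons size_bernoulli_coefs.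
rewrite ltnn eqxx; case: n IHn => [|n] IHn.
  by rewrite big_ord0 subr0 normr1.
rewrite sub0r normrN (le_trans (ler_norm_sum _ _ _))//.
have step m : (m.+1.+1)`!%:R^-1 <= m.+1%:R^-1 - m.+2%:R^-1 :> R.
  have -> : m.+1%:R^-1 - m.+2%:R^-1 = (m.+2 * m.+1)%:R^-1 :> R.
    have y0 : m.+1%:R != 0 :> R by rewrite pnatr_eq0.
    have z0 : m.+2%:R != 0 :> R by rewrite pnatr_eq0.
    rewrite natrM; move: z0; rewrite -[m.+2%:R](natr1 m.+1).
    by move: (m.+1%:R : R) y0 => y y0 z0; field; rewrite y0 z0.
  by rewrite lef_pV2 ?posrE ?ltr0n ?fact_gt0// ler_nat !factS leq_mul ?leq_pmulr ?fact_gt0.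
have bnd k : (k < n.+1)%N ->
    `|(bernoulli_coefs n.+1)`_k / (n.+1 - k).+1`!%:R| <=
    (n.+1 - k)%:R^-1 - (n.+1 - k).+1%:R^-1.
  move=> kn; rewrite normrM normfV normr_nat nth_bernoulli_coefs//.
  rewrite subSn//= (le_trans _ (step _))//.
  by rewrite ler_piMl ?invr_ge0// IHn.
apply: (@le_trans _ _ (\sum_(0 <= k < n.+1)
    ((n.+1 - k)%:R^-1 - (n.+1 - k).+1%:R^-1))).
  by rewrite big_mkord; apply: ler_sum => k _; exact: bnd.
have tele := @telescope_sumr R 0 n.+1 (fun k => (n.+2 - k)%:R^-1) (leq0n _).
rewrite (eq_big_nat _ _ (F2 := fun k => (n.+2 - k.+1)%:R^-1 - (n.+2 - k)%:R^-1)).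
  by rewrite tele subSnn subn0 invr1 gerBl invr_ge0.
by move=> k /andP[_ kn]; rewrite subSS [(n.+2 - k)%N]subSn// ltnW.
Qed.

Lemma bernoulli_gf (x : R) : 0 < `|x| < 1 ->
  series (fun k => bernoulli k * x ^+ k / k`!%:R) @ \oo --> x / (expR x - 1).
Proof.
move=> /andP[]; rewrite normr_gt0 => x0 x1.
pose a k := bernoulli k * x ^+ k / k`!%:R.
pose c j : R := x ^+ j / j.+1`!%:R.
pose C m := \sum_(0 <= j < m) c j.
pose L := (expR x - 1) / x.
have e0 : expR x - 1 != 0.
  by rewrite subr_eq0 -expR0; apply: contra x0 => /eqP/expR_inj ->.
have CL : C @ \oo --> L.
  have -> : C = (fun m => (series (exp_coeff x) m.+1 - 1) / x).
    apply/funext => m; rewrite /C /series /= big_nat_recl//.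
    rewrite /exp_coeff /= expr0 fact0 divr1 addrC addKr mulr_suml.
    by apply: eq_bigr => j _; rewrite exprS mulrAC [_ / x]mulrAC mulfV// mul1r.
  apply: cvgMl; apply: cvgB; last exact: cvg_cst.
  by rewrite cvg_shiftS; exact: is_cvg_series_exp_coeff.
have cb j : `|c j| <= `|x| ^+ j * 2^-1 ^+ j.
  rewrite normrM normrX normfV normr_nat ler_wpM2l ?exprn_ge0//.
  rewrite exprVn lef_pV2 ?posrE ?exprn_gt0 ?ltr0n ?fact_gt0//.
  rewrite -natrX ler_nat; elim: j => // j IHj.
  by rewrite expnS factS leq_mul.
have tail m p : (m <= p)%N -> `|C p - C m| <= `|x| ^+ m * 2^-1 ^+ m * 2.
  move=> mp; rewrite /C (@big_cat_nat _ _ _ m 0 p)//= [X in `|X|]addrC addKr.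
  rewrite (le_trans (ler_norm_sum _ _ _))//.
  apply: (@le_trans _ _ (`|x| ^+ m * (2 * 2^-1 ^+ m - 2 * 2^-1 ^+ p))).
    rewrite -(subnK mp); elim: (p - m)%N => [|q IHq].
      by rewrite add0n big_geq// subrr mulr0.
    rewrite addSn big_nat_recr ?leq_addl//=.
    have := cb (q + m)%N; move: IHq => /=; set s := \sum_(_ <= _ < _) _.
    have : `|x| ^+ (q + m) * 2^-1 ^+ (q + m) <= `|x| ^+ m * 2^-1 ^+ (q + m).
      rewrite ler_wpM2r ?exprn_ge0// exprD ler_piMl ?exprn_ge0//.
      by rewrite exprn_ile1// ltW.
    rewrite (exprS _ (q + m)); lra.
  rewrite -mulrA ler_wpM2l ?exprn_ge0// mulrC gerBl.
  by rewrite mulr_ge0 ?exprn_ge0.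
have tailL m : `|L - C m| <= `|x| ^+ m * 2^-1 ^+ m * 2.
  have h : `|C p - C m| @[p --> \oo] --> `|L - C m|.
    by apply: cvg_norm; apply: cvgB => //; exact: cvg_cst.
  by apply: (cvgr_to_le h); near=> p; apply: tail; near: p; exists m.
have conv N : \sum_(0 <= k < N.+1) a k * C (N.+1 - k)%N = 1.
  have delta n : \sum_(0 <= k < n.+1) a k * c (n - k)%N = (n == 0)%:R.
    rewrite -(bernoulli_rec n) big_mkord.
    transitivity (x ^+ n *
        \sum_(k < n.+1) bernoulli k / k`!%:R / (n - k).+1`!%:R).
      rewrite mulr_sumr; apply: eq_bigr => k _.
      rewrite /a /c -[in x ^+ n](subnK (ltnSE (ltn_ord k))) exprD; ring.
    by rewrite bernoulli_rec; case: n => [|n]; rewrite ?mul1r ?mulr0.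
  elim: N => [|N IHN].
    rewrite big_nat1 subn0 /C big_nat1; have := delta 0.
    by rewrite big_nat1 subnn.
  rewrite big_nat_recr//= subSnn -IHN /C big_nat1.
  apply/eqP; rewrite -subr_eq0 -addrA addrCA -sumrB; apply/eqP.
  have := delta N.+1; rewrite big_nat_recr//= subnn addrC => d.
  apply: etrans d; congr (_ + _); apply: eq_big_nat => k /andP[_ kN].
  by rewrite -mulrBr subSn ?(ltnW kN)// big_nat_recr//= addrAC subrr add0r.
have L0 : L != 0 by rewrite mulf_neq0 ?invr_eq0.
pose S N := \sum_(0 <= k < N) a k.
have err N : `|S N.+1 * L - 1| <= `|x| ^+ N.+1 * 2.
  rewrite -[X in _ - X](conv N) mulr_suml -sumrB.
  rewrite (le_trans (ler_norm_sum _ _ _))//.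
  apply: (@le_trans _ _ (\sum_(0 <= k < N.+1)
      `|x| ^+ N.+1 * (2 * (2^-1 ^+ (N.+1 - k.+1) * 2^-1)))).
    apply: ler_sum_nat => k /andP[_ kN].
    have ab : `|a k| <= `|x| ^+ k.
      rewrite /a mulrAC normrM normrX ler_piMl ?exprn_ge0//.
      exact: normr_bernoulli_le.
    rewrite -mulrBr normrM -exprSr -subSn// subSS.
    rewrite -[in leRHS](subnKC (ltnW kN)) exprD -mulrA ler_pM//.
    by rewrite (le_trans (tailL _))// addKn -mulrA [2 * _]mulrC.
  rewrite -mulr_sumr ler_wpM2l ?exprn_ge0//.
  rewrite -mulr_sumr ler_piMr// big_nat_rev /= add0n.
  have : forall M, \sum_(0 <= i < M) 2^-1 ^+ i * 2^-1 = 1 - 2^-1 ^+ M :> R.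
    elim=> [|M IHM]; first by rewrite big_geq// expr0 subrr.
    by rewrite big_nat_recr//= IHM exprS; field.
  move=> geo.
  rewrite (eq_big_nat _ _ (F2 := fun i => 2^-1 ^+ i * 2^-1)).
    by rewrite geo gerBl exprn_ge0.
  by move=> i /andP[_ iN]; rewrite !subSS subKn.
have SL : S N * L @[N --> \oo] --> (1 : R).
  rewrite -(cvg_shiftS (fun n => S n * L)).
  apply/subr_cvg0/norm_cvg0P.
  have h : `|x| ^+ n.+1 * 2 @[n --> \oo] --> (0 : R).
    rewrite -[X in _ --> X](mul0r 2); apply: cvgMl.
    rewrite (cvg_shiftS (fun n => `|x| ^+ n)); apply: cvg_expr.
    by rewrite normr_id.
  apply: (squeeze_cvgr _ (cvg_cst 0) h).
  by near=> n; rewrite normr_ge0 err.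
have -> : x / (expR x - 1) = 1 * L^-1 by rewrite mul1r invf_div.
rewrite (_ : series _ = (fun N => S N * L / L)); last first.
  by apply/funext => N; rewrite mulfK.
by apply: cvgMl.
Unshelve. all: by end_near. Qed.

End Bernoulli.

Section Cumulants.
Variables (R : realType) (mu : probability R R).

Definition has_all_moments : Prop :=
  forall k, mu.-integrable [set: R] (fun x => (x ^+ k)%:E).

Definition moment k : R := fine 'E_mu[fun x => x ^+ k].

(* k! times the coefficient of t^k in the formal power series
   log (E[exp (t X)]) = \sum_(r >= 1) (-1)^(r-1) / r * M^r, where
   M = \sum_(j >= 1) E[X^j] t^j / j!; only r, j <= k contribute.  Meaningful
   when the moments up to order k exist. *)
Definition cumulant k : R :=
  k`!%:R * (\sum_(1 <= r < k.+1) ((-1) ^+ r.-1 / r%:R) *: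
    (\sum_(1 <= j < k.+1) (moment j / j`!%:R) *: 'X^j) ^+ r)`_k.

End Cumulants.

Definition cvg_in_distribution (R : realType)
    (mu_ : nat -> probability R R) (mu : probability R R) : Prop :=
  forall f : R -> R, continuous f -> bounded_fun f ->
    (\int[mu_ n]_x (f x)%:E)%E @[n --> \oo] --> (\int[mu]_x (f x)%:E)%E.

(* Main.v *)
From HB Require Import structures.
Require Import Defs.
From mathcomp Require Import all_boot all_order all_algebra.
From mathcomp Require Import perm ring lra zify.
From mathcomp Require Import all_classical all_reals all_analysis.
From mathcomp Require Import measurable_realfun.

(** Let z_v be the number of descendants of the node v, itself included, and
    R_v the number of nodes of the subtree of v whose label is smaller than
    that of v.  Then I(T) is the sum of the R_v, and the R_v are independent
    with R_v uniform on {0, ..., z_v - 1}: exchanging the label of v with the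
    next label occurring in its subtree increases R_v by one and changes no
    other R_u, so that all values of R_v are equally likely given the others
    ([sum_prod_rank_uniform]).  Hence the generating function of I(T) is a
    product of q-integers ([inversions_gf]).

    Taking logarithmic derivatives of this product in the ring of formal power
    series gives the cumulants of I(T): for k >= 2 the k-th one is
    B_k / k * (Upsilon_k - n), because Upsilon_k is the sum of the z_v ^ k
    ([UpsilonE], [inversion_cumulant_rel]).  After normalization they converge
    to the announced values, since n / Upsilon_2 ^ k tends to 0 (the root alone
    contributes n ^ 2 to Upsilon_2); the odd ones vanish.

    The same product bounds E[exp (t X_n)] by exp (t ^ 2 / 2) for all t and n
    ([mgf_normalized_inversions_le]).  The X_n are therefore tight, and every
    subsequence has a further subsequence converging in distribution (Helly
    selection, [tight_subsequence]).  Along it the moments and exponential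
    moments converge too, being bounded in square mean
    ([cvg_integral_of_square_bound]); as moments and cumulants determine one
    another through a recursion ([cumulant_rel]), the limit has the required
    cumulants.

    There is only one law with these cumulants.  They determine the moments
    ([cumulants_determine_moments]), and as exp (t x) is integrable for all t
    the moments determine the integrals of trigonometric polynomials, whose
    bounded pointwise limits include the indicators of half-lines
    ([moments_determine_measure]).  All subsequential limits thus coincide,
    and the whole sequence converges. *)

Set Implicit Arguments.
Unset Strict Implicit.
Unset Printing Implicit Defensive.

Import Order.TTheory GRing.Theory Num.Theory.
Import numFieldNormedType.Exports.

Local Open Scope classical_set_scope.
Local Open Scope ring_scope.

(** * The ranks of the nodes in their subtrees are independent and uniform *)

Section Subtrees.
Variable T : rooted_tree.
Implicit Types u v w x : T.

Definition subtree_size v : nat := #|[pred w : T | ancestor v w]|.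

Lemma ancestor_refl v : ancestor v v.
Proof. exact: connect0. Qed.

Lemma ancestor_trans u v w : ancestor u v -> ancestor v w -> ancestor u w.
Proof. by move=> uv vw; exact: connect_trans vw uv. Qed.

Lemma ancestor_iterP u v :
  reflect (exists n, u = iter n (@parent T) v) (ancestor u v).
Proof.
apply: (iffP idP) => [|[n ->]]; last exact: fconnect_iter.
by move=> uv; exists (findex (@parent T) v u); rewrite iter_findex.
Qed.

(** A node on a cycle of [parent] would be the root, which is its own
    parent. *)
Lemma ancestor_anti u v : ancestor u v -> ancestor v u -> u = v.
Proof.
move=> /ancestor_iterP[a ua] /ancestor_iterP[b vb].
have itr n : iter n (@parent T) (Defs.root T) = Defs.root T.
  by elim: n => //= n ->; exact: parent_root.
have [|c0] := posnP (a + b).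
  by move/eqP; rewrite addn_eq0 => /andP[/eqP a0 _]; rewrite ua a0.
have pu k : iter (k * (a + b)) (@parent T) u = u.
  elim: k => // k IHk.
  by rewrite mulSn iterD IHk iterD -vb -ua.
have /ancestor_iterP[m rm] := root_reachable u.
have ur : u = Defs.root T.
  rewrite -(pu m) -(subnK (leq_pmulr m c0)) iterD -rm; exact: itr.
by rewrite vb ur itr.
Qed.

Lemma ancestor_comparable u v w :
  ancestor u w -> ancestor v w -> ancestor u v || ancestor v u.
Proof.
move=> /ancestor_iterP[a ->] /ancestor_iterP[b ->].
have [ab|/ltnW ba] := leqP a b.
  by rewrite -(subnK ab) iterD; apply/orP; right; exact: fconnect_iter.
by rewrite -(subnK ba) iterD; apply/orP; left; exact: fconnect_iter.
Qed.

Lemma subtree_size_gt0 v : (0 < subtree_size v)%N.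
Proof. by apply/card_gt0P; exists v; rewrite inE ancestor_refl. Qed.

Lemma subtree_size_root : subtree_size (Defs.root T) = #|T|.
Proof. by apply: eq_card => v; rewrite !inE; exact: root_reachable. Qed.

(** Both sides count the pairs of a node u and a k-tuple of descendants of
    u. *)
Lemma UpsilonE k : Upsilon T k = (\sum_(v : T) subtree_size v ^ k)%N.
Proof.
transitivity (\sum_(v : {ffun 'I_k ->
  T}) \sum_(u : T) [forall i, ancestor u (v i)])%N.
  apply: eq_bigr => v _; rewrite /common_ancestors -sum1_card big_mkcond /=.
  by apply: eq_bigr => u _; rewrite inE; case: [forall _, _].
rewrite exchange_big /=; apply: eq_bigr => u _.
transitivity #|[pred v : {ffun 'I_k -> T} | [forall i, ancestor u (v i)]]|.
  rewrite -sum1_card [RHS]big_mkcond /=.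
  by apply: eq_bigr => v _; rewrite inE; case: [forall _, _].
rewrite /subtree_size.
rewrite -[k in RHS]card_ord -card_ffun_on; apply: eq_card => f.
rewrite [LHS]inE; apply/forallP/ffun_onP => h i; have := h i; by rewrite ?inE.
Qed.

End Subtrees.

Section Ranks.
Variable T : rooted_tree.
Implicit Types (u v w x : T) (l : labelling T).

(** For w = v this is the number R_v of inversions in which v is the
    ancestor. *)
Definition rank_in l v w : nat :=
  #|[pred x : T | ancestor v x & (l x < l w)%N]|.

Lemma label_injective l : injective l.
Proof. exact/injectiveP/(label_inj l). Qed.

Lemma inversionsE l : inversions l = (\sum_(v : T) rank_in l v v)%N.
Proof.
apply: eq_bigr => u _.
rewrite /rank_in -[RHS]sum1_card [RHS]big_mkcond [LHS]big_mkcond /=.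
apply: eq_bigr => v _; rewrite inE /proper_ancestor.
have [<-|uv] := eqVneq u v; first by rewrite ltnn andbF.
by case: ancestor => //=; case: (_ < _)%N.
Qed.

Lemma rank_in_mono l v w x : ancestor v w -> ancestor v x ->
  (rank_in l v w < rank_in l v x)%N = (l w < l x)%N.
Proof.
move=> vw vx.
have mono y z : ancestor v y -> (l y < l z)%N ->
  (rank_in l v y < rank_in l v z)%N.
  move=> vy yz; apply: proper_card; apply/properP; split.
    apply/fintype.subsetP => t; rewrite !inE => /andP[-> /=] /ltn_trans; exact.
  by exists y; rewrite !inE vy //= ltnn.
apply/idP/idP; last exact: mono.
apply: contraLR; rewrite -!leqNgt leq_eqVlt =>
  /predU1P[/val_inj/label_injective->//|].
by move/(mono _ _ vx)/ltnW.
Qed.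

Lemma rank_in_lt l v w : ancestor v w -> (rank_in l v w < subtree_size v)%N.
Proof.
move=> vw; apply: proper_card; apply/properP; split.
  by apply/fintype.subsetP => t; rewrite !inE => /andP[].
by exists w; rewrite !inE vw //= ltnn.
Qed.

Lemma rank_in_inj l v w x : ancestor v w -> ancestor v x ->
  rank_in l v w = rank_in l v x -> w = x.
Proof.
move=> vw vx wx; apply: (@label_injective l); apply: val_inj.
have := rank_in_mono l vw vx; have := rank_in_mono l vx vw.
by rewrite wx ltnn /=; case: ltngtP.
Qed.

(** Ranks in a subtree are distinct and smaller than its size, hence exhaust
    all values below it. *)
Lemma rank_in_surj l v i : (i < subtree_size v)%N ->
  exists2 w, ancestor v w & rank_in l v w = i.
Proof.
move=> iz.
pose S := {w : T | ancestor v w}.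
have cS : #|{: S}| = subtree_size v by rewrite card_sig.
pose f (s : S) : 'I_(subtree_size v) := Ordinal (rank_in_lt l (valP s)).
have fI : injective f.
  move=> s t /(congr1 val) /= st; apply: val_inj.
  exact: rank_in_inj (valP s) (valP t) st.
have /codomP[s /(congr1 val) /= ->] : Ordinal iz \in codom f.
  by apply: inj_card_onto => //; rewrite card_ord cS.
by exists (val s) => //; exact: (valP s).
Qed.

End Ranks.

Section RankSwap.
Variables (T : rooted_tree) (v : T).
Implicit Types (u w x : T) (l : labelling T).

Lemma relabel_subproof l (s : {perm T}) : injectiveb [ffun x => l (s x)].
Proof.
apply/injectiveP => x y; rewrite !ffunE => /label_injective; exact: perm_inj.
Qed.

Definition relabel l (s : {perm T}) : labelling T :=
  Labelling (relabel_subproof l s).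

(** A permutation preserving the subtree of u leaves its set of labels
    unchanged, so the rank travels with the label. *)
Lemma rank_in_relabel l (s : {perm T}) u w :
  (forall x, ancestor u (s x) = ancestor u x) ->
  rank_in (relabel l s) u w = rank_in l u (s w).
Proof.
move=> su; rewrite /rank_in -[LHS]sum1_card -[RHS]sum1_card.
rewrite [RHS](reindex_inj (@perm_inj _ s)) /=.
by apply: eq_bigl => x; rewrite !inE su !ffunE.
Qed.

Definition node_of_rank l i : T :=
  odflt v [pick w | ancestor v w && (rank_in l v w == i)].

Lemma node_of_rankP l i : (i < subtree_size v)%N ->
  ancestor v (node_of_rank l i) /\ rank_in l v (node_of_rank l i) = i.
Proof.
move=> /(rank_in_surj l)[w vw wi]; rewrite /node_of_rank.
case: pickP => [x /andP[-> /eqP//]|/(_ w)].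
by rewrite vw wi eqxx.
Qed.

Lemma node_of_rank_eq l w : ancestor v w -> node_of_rank l (rank_in l v w) = w.
Proof.
move=> vw; have [h1 h2] := node_of_rankP l (rank_in_lt l vw).
exact: rank_in_inj h1 vw h2.
Qed.

(** Gives v the rank i in its subtree by exchanging two labels. *)
Definition set_rank i l : labelling T := relabel l (tperm v (node_of_rank l i)).

Lemma ancestor_tperm w u x : ancestor v w -> ancestor u v ->
  ancestor u (tperm v w x) = ancestor u x.
Proof.
move=> vw uv; case: tpermP => [->|->|//]; by rewrite uv (ancestor_trans uv vw).
Qed.

Lemma rank_in_set_rank l i : (i < subtree_size v)%N ->
  rank_in (set_rank i l) v v = i.
Proof.
move=> /(node_of_rankP l)[vw wi].
by rewrite rank_in_relabel ?tpermL// => x;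
  rewrite ancestor_tperm// ancestor_refl.
Qed.

Lemma set_rankK l i : (i < subtree_size v)%N ->
  set_rank (rank_in l v v) (set_rank i l) = l.
Proof.
move=> /(node_of_rankP l)[vw wi].
have -> : rank_in l v v = rank_in (set_rank i l) v (node_of_rank l i).
  by rewrite rank_in_relabel ?tpermR// => x;
    rewrite ancestor_tperm// ancestor_refl.
rewrite /set_rank node_of_rank_eq //.
by apply: val_inj; apply/ffunP => x; rewrite !ffunE tpermK.
Qed.

(** The exchanged labels are consecutive among those of the subtree of v. If u
    is an ancestor of v, the label of u and the set of labels below u are
    unchanged; if u is below v, the order of the labels of the nodes other
    than v is unchanged, precisely because the two labels are consecutive;
    otherwise the two subtrees are disjoint, ancestors of a node being
    comparable. *)
Lemma rank_in_set_rank_other l i u : u != v -> (i < subtree_size v)%N ->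
  (i == (rank_in l v v).+1) || (i.+1 == rank_in l v v) ->
  rank_in (set_rank i l) u u = rank_in l u u.
Proof.
move=> uv /(node_of_rankP l)[]; set w := node_of_rank l i => vw wi adj.
(* If u is an ancestor of v, the exchange permutes the labels below u. *)
have [uav|uav] := boolP (ancestor u v).
  rewrite rank_in_relabel => [|x]; last by rewrite ancestor_tperm.
  rewrite tpermD // 1?eq_sym //; apply: contra uv => /eqP uw.
  by apply/eqP; apply: ancestor_anti; rewrite // uw.
have subv x : ancestor v u -> ancestor u x -> ancestor v x /\ x != v.
  move=> vu ux; split; first exact: ancestor_trans vu ux.
  by apply: contra uav => /eqP <-.
apply: eq_card => x; rewrite !inE; have [ux|//] := boolP (ancestor u x).
rewrite /= !ffunE -/w.
(* If u is neither above nor below v, the exchange does not touch its subtree. *)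
have [vu|vu] := boolP (ancestor v u); last first.
  have nd y : ancestor u y -> tperm v w y = y.
    move=> uy; have nvy : ~~ ancestor v y.
      apply/negP => vy; have := ancestor_comparable uy vy.
      by rewrite (negbTE uav) (negbTE vu).
    rewrite tpermD //; apply: contra nvy => /eqP <- //; exact: ancestor_refl.
  by rewrite !nd // ancestor_refl.
have sw y : ancestor v (tperm v w y) = ancestor v y.
  by rewrite ancestor_tperm // ancestor_refl.
have [vx xv] := subv x vu ux.
have [_ _] := subv u vu (ancestor_refl u).
rewrite -(@rank_in_mono _ l v) ?sw // -[RHS](@rank_in_mono _ l v) //.
have rk y : ancestor v y -> y != v -> rank_in l v y <> rank_in l v v.
  by move=> vy /eqP yv /(rank_in_inj vy (ancestor_refl v)).
have rki y : ancestor v y -> y != w -> rank_in l v y <> i.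
  by move=> vy /eqP yw; rewrite -wi => /(rank_in_inj vy vw).
(* The ranks in the subtree of v are consecutive on v and w, and x and u
   differ from v: comparing them cannot distinguish these two ranks. *)
have := rk x vx xv; have := rk u vu uv.
case: tpermP => [ex|->|_ /eqP xw]; first by rewrite ex eqxx in xv.
  case: tpermP => [eu|->|_ /eqP uw]; first by rewrite eu eqxx in uv.
    by rewrite !ltnn.
  by have := rki u vu uw; move: adj; rewrite wi; lia.
case: tpermP => [eu|->|_ /eqP uw]; first by rewrite eu eqxx in uv.
  by have := rki x vx xw; move: adj; rewrite wi; lia.
by have := rki x vx xw; have := rki u vu uw; move: adj; lia.
Qed.

End RankSwap.

Section RankUniform.
Variables (T : rooted_tree) (A : comNzRingType).
Implicit Types (u v : T) (l : labelling T).

(** Raising the rank of v by one is a bijection between labellings that leaves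
    f unchanged, hence the sum of f over the labellings giving v the rank i
    does not depend on i. *)
Lemma sum_rank_uniform v (f : labelling T -> A) (g : nat -> A) :
    (forall l i, (i < subtree_size v)%N ->
       (i == (rank_in l v v).+1) || (i.+1 == rank_in l v v) ->
       f (set_rank v i l) = f l) ->
  (subtree_size v)%:R * (\sum_l g (rank_in l v v) * f l) =
  (\sum_(j < subtree_size v) g j) * \sum_l f l.
Proof.
move=> fS; set z := subtree_size v.
pose S i := \sum_(l | rank_in l v v == i) f l.
(* Setting the rank to i + 1 and to i are inverse bijections. *)
have SS i : (i.+1 < z)%N -> S i.+1 = S i.
  move=> iz; have iz' := ltnW iz.
  rewrite /S (reindex_onto (set_rank v i.+1) (set_rank v i)) /=; last first.
    by move=> l /eqP li; rewrite -{1}li set_rankK.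
  apply: eq_big => [l|l]; rewrite rank_in_set_rank // eqxx /=.
    apply/eqP/eqP => [h|li]; first by rewrite -h rank_in_set_rank.
    by rewrite -{1}li set_rankK.
  move=> /eqP li; apply: (fS l i.+1 iz).
  by rewrite -[in rank_in l v v]li rank_in_set_rank // eqxx.
have S0 i : (i < z)%N -> S i = S 0%N.
  by elim: i => // i IHi iz; rewrite SS // IHi // ltnW.
have part (h : nat -> A) :
    \sum_l h (rank_in l v v) * f l = (\sum_(j < z) h j) * S 0%N.
  rewrite (partition_big (fun l =>
    Ordinal (rank_in_lt l (ancestor_refl v))) predT) //=.
  rewrite mulr_suml; apply: eq_bigr => j _; rewrite -(S0 j) // mulr_sumr.
  by apply: eq_big => [l|l /eqP <-].
rewrite part mulrCA; congr (_ * _).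
have := part (fun=> 1); rewrite sumr_const card_ord => <-.
by apply: eq_bigr => l _; rewrite mul1r.
Qed.

(** This is the independence of the uniform ranks R_v, as a product formula
    for expectations. *)
Lemma sum_prod_rank_uniform (g : T -> nat -> A) :
  (\prod_(v : T) (subtree_size v)%:R) * (\sum_l \prod_v g v (rank_in l v v)) =
  #|{: labelling T}|%:R * \prod_v \sum_(j < subtree_size v) g v j.
Proof.
suff: forall s : seq T, uniq s ->
    (\prod_(v <- s) (subtree_size v)%:R) *
      (\sum_l \prod_(v <- s) g v (rank_in l v v)) =
    #|{: labelling T}|%:R * \prod_(v <- s) \sum_(j < subtree_size v) g v j.
  by apply; exact: index_enum_uniq.
elim=> [_|v s IHs /= /andP[vs us]].
  rewrite !big_nil mul1r mulr1.
  by under eq_bigr do rewrite big_nil; rewrite sumr_const.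
rewrite !big_cons; under [\sum_l _]eq_bigr do rewrite big_cons.
rewrite mulrAC sum_rank_uniform => [|l i iz adj].
  by rewrite -mulrA [X in _ * X]mulrC IHs // mulrCA.
apply: eq_big_seq => u us'; rewrite rank_in_set_rank_other //.
by apply: contra vs => /eqP <-.
Qed.

Lemma inversions_gf (q : A) :
  (\prod_(v : T) (subtree_size v)%:R) * (\sum_(l : labelling T) q ^+ inversions
    l) =
  #|{: labelling T}|%:R * \prod_(v : T) \sum_(j < subtree_size v) q ^+ j.
Proof.
rewrite -(sum_prod_rank_uniform (fun _ j => q ^+ j)); congr (_ * _).
by apply: eq_bigr => l _; rewrite inversionsE expr_sum.
Qed.

End RankUniform.

(** * Formal power series and cumulants *)

Section TruncatedSeries.
Variable R : fieldType.
Implicit Types (p q r d : {poly R}) (n : nat).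

(** Equality modulo 'X^n: a polynomial stands for a truncated power series. *)
Definition eqpX n p q : Prop := take_poly n p = take_poly n q.

Lemma eqpXP n p q :
  eqpX n p q <-> (forall k, (k < n)%N -> p`_k = q`_k).
Proof.
split=> [/polyP pq k kn|pq]; first by have := pq k; rewrite !coef_take_poly kn.
by apply/polyP => k; rewrite !coef_take_poly; case: ifP => // /pq.
Qed.

Lemma eqpX_refl n p : eqpX n p p. Proof. by []. Qed.
#[local] Hint Resolve eqpX_refl : core.

Lemma eqpX_sym n p q : eqpX n p q -> eqpX n q p. Proof. exact: esym. Qed.

Lemma eqpX_trans n q p r : eqpX n p q -> eqpX n q r -> eqpX n p r.
Proof. exact: etrans. Qed.

Lemma eqpX_leq n m p q : (m <= n)%N -> eqpX n p q -> eqpX m p q.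
Proof.
move=> mn /eqpXP pq; apply/eqpXP => k km.
by rewrite pq // (leq_trans km).
Qed.

Lemma eqpXD n p q p' q' : eqpX n p q -> eqpX n p' q' ->
  eqpX n (p + p') (q + q').
Proof.
by move=> /eqpXP pq /eqpXP pq'; apply/eqpXP => k kn; rewrite !coefD pq // pq'.
Qed.

Lemma eqpXN n p q : eqpX n p q -> eqpX n (- p) (- q).
Proof. by move=> /eqpXP pq; apply/eqpXP => k kn; rewrite !coefN pq. Qed.

Lemma eqpXM n p q p' q' : eqpX n p q -> eqpX n p' q' ->
  eqpX n (p * p') (q * q').
Proof.
move=> /eqpXP pq /eqpXP pq'; apply/eqpXP => k kn; rewrite !coefM.
apply: eq_bigr => i _.
by rewrite pq ?pq' // (leq_ltn_trans _ kn) ?leq_subr // -ltnS.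
Qed.

Lemma eqpX_prod n (I : Type) (s : seq I) (F G : I -> {poly R}) :
  (forall i, eqpX n (F i) (G i)) ->
    eqpX n (\prod_(i <- s) F i) (\prod_(i <- s) G i).
Proof.
by move=> FG; elim/big_ind2: _ => // *; exact: eqpXM.
Qed.

Lemma eqpX_sum n (I : Type) (s : seq I) (F G : I -> {poly R}) :
  (forall i, eqpX n (F i) (G i)) ->
    eqpX n (\sum_(i <- s) F i) (\sum_(i <- s) G i).
Proof.
by move=> FG; elim/big_ind2: _ => // *; exact: eqpXD.
Qed.

Lemma eqpX_deriv n p q : eqpX n.+1 p q -> eqpX n p^`() q^`().
Proof. by move=> /eqpXP pq; apply/eqpXP => k kn; rewrite !coef_deriv pq. Qed.

Lemma eqpX_mulX n p q : eqpX n.+1 ('X * p) ('X * q) -> eqpX n p q.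
Proof.
move=> /eqpXP pq; apply/eqpXP => k kn.
by have := pq k.+1 kn; rewrite !coefXM.
Qed.

(** A power series with nonzero constant term is invertible. *)
Lemma eqpX_mulI n p q r : p`_0 != 0 -> eqpX n (p * q) (p * r) -> eqpX n q r.
Proof.
move=> p0 /eqpXP pqr; apply/eqpXP; elim/ltn_ind => k IHk kn.
have := pqr k kn; rewrite !coefM !big_ord_recl /= !subn0.
have -> : \sum_(i < k) p`_(bump 0 i) * q`_(k - bump 0 i) =
          \sum_(i < k) p`_(bump 0 i) * r`_(k - bump 0 i).
  by apply: eq_bigr => i _; rewrite IHk // /bump; have := ltn_ord i; lia.
by move=> /addIr /(mulfI p0).
Qed.

(** Modulo 'X^n, the series d is p' / p. *)
Definition log_deriv n p d := eqpX n p^`() (p * d).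

Lemma log_derivM n p q d e : log_deriv n p d -> log_deriv n q e ->
  log_deriv n (p * q) (d + e).
Proof.
move=> pd qe; rewrite /log_deriv derivM.
apply: eqpX_trans (eqpXD (eqpXM pd (@eqpX_refl n q)) (eqpXM (@eqpX_refl n p)
  qe)) _.
by rewrite (_ : p * d * q + _ = p * q * (d + e)) //; ring.
Qed.

Lemma log_deriv1 n : log_deriv n 1 0.
Proof. by rewrite /log_deriv -[1]/(1%:P) derivC mulr0. Qed.

Lemma log_derivZ n a p d : log_deriv n p d -> log_deriv n (a *: p) d.
Proof.
by move=> /eqpXP pd; apply/eqpXP => k kn; rewrite derivZ -scalerAl !coefZ pd.
Qed.

Lemma log_deriv_prod n (I : Type) (s : seq I) (F D : I -> {poly R}) :
  (forall i, log_deriv n (F i) (D i)) ->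
  log_deriv n (\prod_(i <- s) F i) (\sum_(i <- s) D i).
Proof.
move=> FD; elim/big_ind2: _ => //; first exact: log_deriv1.
by move=> *; exact: log_derivM.
Qed.

(** Differentiating p * q costs one order of precision. *)
Lemma log_deriv_div n p q r d e : q`_0 != 0 -> eqpX n.+1 (p * q) r ->
  log_deriv n q d -> log_deriv n r e -> log_deriv n p (e - d).
Proof.
move=> q0 pqr qd re; apply: (@eqpX_mulI n q) => //.
have h : eqpX n (p^`() * q + p * (q * d)) (p * q * e).
  apply: (@eqpX_trans _ (p * q)^`()).
    by rewrite derivM; apply: eqpXD => //; apply: eqpXM => //; exact: eqpX_sym.
  apply: eqpX_trans (eqpX_deriv pqr) _; apply: eqpX_trans re _.
  by apply: eqpXM => //; apply: eqpX_sym; exact: eqpX_leq pqr.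
have := eqpXD h (@eqpX_refl n (- (p * (q * d)))).
rewrite addrK (_ : p * q * e - _ = q * (p * (e - d))); last by ring.
by rewrite mulrC.
Qed.

End TruncatedSeries.
#[local] Hint Resolve eqpX_refl : core.

Section ExponentialSeries.
Variable R : realType.
Implicit Types (a b : R) (n k : nat).

Let fact_neq0 k : k`!%:R != 0 :> R.
Proof. by rewrite pnatr_eq0 -lt0n fact_gt0. Qed.

Definition egf n (m : nat -> R) : {poly R} := \poly_(k < n) (m k / k`!%:R).

Definition exps n a := egf n (fun k => a ^+ k).

(** The series (exp (a X) - 1) / X. *)
Definition expm1X n a : {poly R} := \poly_(k < n) (a ^+ k.+1 / k.+1`!%:R).

(** The series a X / (exp (a X) - 1), defined for a = 0 as well. *)
Definition bern n a : {poly R} := egf n (fun k => bernoulli R k * a ^+ k).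

(** The series ([bern] - 1) / X. *)
Definition bernX n a : {poly R} :=
  \poly_(k < n) (bernoulli R k.+1 * a ^+ k.+1 / k.+1`!%:R).

Lemma coef_egf n (m : nat -> R) k : (k < n)%N -> (egf n m)`_k = m k / k`!%:R.
Proof. by move=> kn; rewrite coef_poly kn. Qed.

Lemma exps0 n : eqpX n (exps n 0) 1.
Proof.
apply/eqpXP => k kn; rewrite coef_egf // coef1 expr0n.
by case: k kn => [|k] _ /=; rewrite ?mul0r ?divr1.
Qed.

Lemma expsD n a b : eqpX n (exps n a * exps n b) (exps n (a + b)).
Proof.
apply/eqpXP => k kn; rewrite coefM coef_egf // addrC exprDn mulr_suml.
apply: eq_bigr => i _; have ik : (i <= k)%N by rewrite -ltnS.
rewrite !coef_egf ?(leq_ltn_trans ik kn) ?(leq_ltn_trans (leq_subr _ _) kn) //.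
have := bin_fact ik => /(congr1 (fun x : nat => x%:R : R));
  rewrite !natrM => <-.
rewrite -mulr_natr invfM.
have c0 : 'C(k, i)%:R != 0 :> R by rewrite pnatr_eq0 -lt0n bin_gt0.
by field; rewrite c0 !fact_neq0.
Qed.

Lemma expsX n a j : eqpX n (exps n a ^+ j) (exps n (a *+ j)).
Proof.
elim: j => [|j IHj]; first by rewrite expr0 mulr0n; apply: eqpX_sym;
  exact: exps0.
rewrite exprS mulrS; apply: (eqpX_trans _ (expsD n a (a *+ j))).
by apply: eqpXM.
Qed.

Lemma exps_deriv n a : log_deriv n (exps n.+1 a) a%:P.
Proof.
apply/eqpXP => k kn; rewrite coef_deriv coefMC coef_egf // coef_egf;
  last exact: ltnW.
rewrite factS natrM exprSr -[LHS]mulr_natr.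
have k0 : k.+1%:R != 0 :> R by rewrite pnatr_eq0.
by move: (k.+1%:R : R) (k`!%:R : R) k0 (fact_neq0 k) => c f c0 f0; field;
  rewrite c0 f0.
Qed.

Lemma expm1XE n a : eqpX n.+1 ('X * expm1X n a) (exps n.+1 a - 1).
Proof.
apply/eqpXP => k kn; rewrite coefXM coefB coef1 coef_egf //;
  case: k kn => [|k] kn /=.
  by rewrite expr0 fact0 divr1 subrr.
by rewrite coef_poly -ltnS kn subr0.
Qed.

(** A geometric sum of ratio exp (a X), with numerator and denominator divided
    by X. *)
Lemma geometric_exps n a z :
  eqpX n (expm1X n a * \sum_(j < z) exps n.+1 a ^+ j) (expm1X n (z%:R * a)).
Proof.
apply: eqpX_mulX; rewrite mulrA.
apply: eqpX_trans (eqpXM (expm1XE n a) (@eqpX_refl _ _ _)) _.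
rewrite -subrX1; apply: (eqpX_trans _ (eqpX_sym (expm1XE n _))).
by rewrite mulr_natl; apply: eqpXD => //; exact: expsX.
Qed.

(** The recursion for Bernoulli numbers says that the two series are inverse
    to one another, up to the factor a. *)
Lemma bern_expm1X n a : eqpX n (bern n a * expm1X n a) a%:P.
Proof.
apply/eqpXP => k kn; rewrite coefM coefC.
transitivity (a ^+ k.+1 *
    \sum_(i < k.+1) bernoulli R i / i`!%:R / (k - i).+1`!%:R).
  rewrite mulr_sumr; apply: eq_bigr => i _.
  have ik : (i <= k)%N by rewrite -ltnS.
  rewrite coef_egf ?(leq_ltn_trans ik kn) // coef_poly.
  rewrite (leq_ltn_trans (leq_subr _ _) kn) -[in a ^+ k.+1](subnKC (leqW ik)).
  by rewrite exprD subSn //; ring.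
by rewrite bernoulli_rec; case: k {kn} => [|k]; rewrite ?mulr1 ?mulr0 ?expr1.
Qed.

Lemma bernoulli0 : bernoulli R 0 = 1.
Proof. by have := bernoulli_rec R 0; rewrite big_ord1 !divr1. Qed.

Lemma bernXE n a : eqpX n.+1 ('X * bernX n a) (bern n.+1 a - 1).
Proof.
apply/eqpXP => k kn; rewrite coefXM coefB coef1 coef_egf //;
  case: k kn => [|k] kn /=.
  by rewrite expr0 fact0 divr1 mulr1 bernoulli0 subrr.
by rewrite coef_poly -ltnS kn subr0.
Qed.

(** Let e be the series (exp (a X) - 1) / X. Differentiating
    X e = exp (a X) - 1 gives X e' = a + a X e - e, and a = e * bern turns
    this into X e' = e * (X * bernX + a X). *)
Lemma expm1X_deriv n a :
  log_deriv n (expm1X n.+1 a) (bernX n a + a%:P).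
Proof.
rewrite /log_deriv; apply: eqpX_mulX.
set e := expm1X n.+1 a; set d := bernX n a.
have h1 : eqpX n.+1 (e + 'X * e^`()) (a%:P * (1 + 'X * e)).
  have /eqpX_deriv := expm1XE n.+1 a; rewrite derivM derivX mul1r derivB.
  rewrite -[1]/(1%:P) derivC subr0 => h; apply: eqpX_trans h _.
  apply: eqpX_trans (exps_deriv _ _) _; rewrite mulrC; apply: eqpXM => //.
  have h := eqpXD (expm1XE n.+1 a) (@eqpX_refl _ _ 1).
  by apply: eqpX_sym; rewrite subrK addrC in h; exact: eqpX_leq h.
have h2 : eqpX n.+1 (e * ('X * d)) (a%:P - e).
  apply: eqpX_trans (eqpXM (@eqpX_refl _ _ e) (bernXE n a)) _.
  rewrite mulrBr mulr1 mulrC; apply: eqpXD => //.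
  have h := bern_expm1X n.+1 a; exact: h.
have h := eqpXD h1 (@eqpX_refl _ n.+1 (- e)); rewrite addrAC subrr add0r in h.
apply: eqpX_trans h _.
have h := eqpXD (eqpX_sym h2) (@eqpX_refl _ n.+1 (e * 'X * a%:P)).
rewrite (_ : 'X * (e * _) = e * ('X * d) + e * 'X * a%:P); last by ring.
apply: (eqpX_trans _ h).
by rewrite (_ : a%:P * _ - e = a%:P - e + e * 'X * a%:P) //; ring.
Qed.

(** The series bern satisfies bern (- a) = bern a + a X, hence is even up to
    its linear term. *)
Lemma bernoulli_odd k : (0 < k)%N -> bernoulli R k.*2.+1 = 0.
Proof.
move=> k0; set n := k.*2.+2.
pose e (a : R) := expm1X n a; pose b (a : R) := bern n a.
have e0 : (e 1)`_0 != 0 by rewrite coef_poly /= expr1 divr1 oner_neq0.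
have h1 : eqpX n (exps n.+1 (-1) * e 1) (- e (-1)).
  apply: eqpX_mulX; rewrite mulrCA mulrN.
  apply: eqpX_trans (eqpXM (@eqpX_refl _ _ _) (expm1XE n 1)) _.
  apply: (eqpX_trans _ (eqpX_sym (eqpXN (expm1XE n (-1))))).
  rewrite mulrBr mulr1 opprB; apply: eqpXD => //.
  apply: eqpX_trans (expsD _ _ _) _; rewrite addNr; exact: exps0.
have h2 : eqpX n (b (-1) * exps n.+1 (-1)) (b 1).
  apply: (@eqpX_mulI _ n (e 1)) => //; rewrite mulrCA [e 1 * _]mulrC.
  apply: eqpX_trans (eqpXM (@eqpX_refl _ _ _) h1) _.
  rewrite mulrN [e 1 * _]mulrC.
  apply: eqpX_trans (eqpXN (bern_expm1X n (-1))) _.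
  rewrite polyCN opprK; exact/eqpX_sym/bern_expm1X.
(* Write exp X as 1 + X * e 1 and use b 1 * e 1 = 1. *)
have h3 : eqpX n (b (-1)) (b 1 + 'X).
  apply: (@eqpX_trans _ _ (b (-1) * exps n.+1 (-1) * exps n.+1 1)).
    rewrite -mulrA -[X in eqpX n X _]mulr1; apply: eqpXM => //.
    apply: eqpX_sym; apply: (@eqpX_leq _ n.+1) => //.
    by apply: eqpX_trans (expsD _ _ _) _; rewrite addNr; exact: exps0.
  apply: eqpX_trans (eqpXM h2 (@eqpX_refl _ _ _)) _.
  apply: (@eqpX_trans _ _ (b 1 * (1 + 'X * e 1))).
    apply: eqpXM => //; apply: eqpX_sym.
    have h := eqpXD (expm1XE n 1) (@eqpX_refl _ _ 1).
    by rewrite subrK addrC in h; exact: eqpX_leq h.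
  rewrite mulrDr mulr1 mulrCA; apply: eqpXD => //.
  rewrite -[X in eqpX _ _ X]mulr1; apply: eqpXM => //; exact: bern_expm1X.
have := (eqpXP _ _ _).1 h3 k.*2.+1 (ltnSn _);
  rewrite coefD coefX !coef_egf // expr1n mulr1.
rewrite -signr_odd /= odd_double /= expr1 mulrN1.
have -> : (k.*2.+1 == 1)%N = false by rewrite eqSS double_eq0 eqn0Ngt k0.
rewrite addr0 mulNr => /eqP;
  rewrite eq_sym -subr_eq0 opprK -mulr2n mulrn_eq0 /=.
by rewrite mulf_eq0 invr_eq0 (negbTE (fact_neq0 _)) orbF => /eqP.
Qed.

End ExponentialSeries.

Section CumulantRecursion.
Variable R : realType.
Implicit Types (m kap : nat -> R) (n k : nat).

Let fact_neq0 k : k`!%:R != 0 :> R.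
Proof. by rewrite pnatr_eq0 -lt0n fact_gt0. Qed.

(** Says, through derivatives, that log (egf m) is the exponential generating
    function of kap without its constant term. *)
Definition cumulant_rel n m kap :=
  log_deriv n (egf n.+1 m) (\poly_(i < n) (kap i.+1 / i`!%:R)).

Lemma coef_deriv_egf n m k : (k < n)%N -> (egf n.+1 m)^`()`_k = m k.+1 / k`!%:R.
Proof.
move=> kn; rewrite coef_deriv coef_egf // factS natrM -[LHS]mulr_natr.
have k0 : k.+1%:R != 0 :> R by rewrite pnatr_eq0.
by move: (k.+1%:R : R) (k`!%:R : R) k0 (fact_neq0 k) => c f c0 f0; field;
  rewrite c0 f0.
Qed.

Lemma cumulant_relP n m kap : cumulant_rel n m kap <->
  forall k, (k < n)%N -> m k.+1 / k`!%:R =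
    \sum_(i < k.+1) m i / i`!%:R * (kap (k - i).+1 / (k - i)`!%:R).
Proof.
have E k : (k < n)%N -> (egf n.+1 m * \poly_(i < n) (kap i.+1 / i`!%:R))`_k =
    \sum_(i < k.+1) m i / i`!%:R * (kap (k - i).+1 / (k - i)`!%:R).
  move=> kn; rewrite coefM; apply: eq_bigr => i _.
  have ik : (i <= k)%N by rewrite -ltnS.
  rewrite coef_egf ?coef_poly; last by rewrite ltnS (leq_trans ik (ltnW kn)).
  by rewrite (leq_ltn_trans (leq_subr _ _) kn).
split=> [/eqpXP h k kn|h]; first by rewrite -E // -h // coef_deriv_egf.
by apply/eqpXP => k kn; rewrite E // -h // coef_deriv_egf.
Qed.

(** [cumulant mu] is this function of the moments of mu; the recursion
    concerns sequences only. *)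
Definition cumulant_seq m k : R :=
  k`!%:R * (\sum_(1 <= r < k.+1) ((-1) ^+ r.-1 / r%:R) *:
    (\sum_(1 <= j < k.+1) (m j / j`!%:R) *: 'X^j) ^+ r)`_k.

(** The derivative of the truncated logarithm is M' times a truncated
    geometric series of ratio - M. *)
Lemma deriv_formal_log (M : {poly R}) k :
  (\sum_(1 <= r < k.+1) ((-1) ^+ r.-1 / r%:R) *: M ^+ r)^`() * (1 + M) =
  M^`() * (1 - (- M) ^+ k).
Proof.
have -> : (\sum_(1 <= r < k.+1) ((-1) ^+ r.-1 / r%:R) *: M ^+ r)^`() =
    M^`() * \sum_(r < k) (- M) ^+ r.
  rewrite big_add1 /= big_mkord raddf_sum mulr_sumr; apply: eq_bigr => r _.
  rewrite /= derivZ deriv_exp /= [(- M) ^+ r]exprNn -[(_ * _) *+ _]scaler_nat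
    scalerA divfK ?pnatr_eq0//.
  rewrite scalerAr; congr (_ * _); rewrite -signr_odd -[in RHS]signr_odd.
  by case: odd; rewrite ?expr0 ?expr1 ?scale1r ?scaleN1r ?mulN1r ?mul1r.
rewrite -mulrA; congr (_ * _).
by apply: oppr_inj; rewrite opprB subrX1; ring.
Qed.

(** By [deriv_formal_log] the truncated logarithm of 1 + M has logarithmic
    derivative M' / (1 + M), because M has no constant term and M ^ (k + 1) is
    negligible. *)
Lemma cumulant_seq_eq k m kap : m 0%N = 1 -> cumulant_rel k.+1 m kap ->
  cumulant_seq m k.+1 = kap k.+1.
Proof.
move=> m0 h; rewrite /cumulant_seq.
pose M : {poly R} := \sum_(1 <= j < k.+2) (m j / j`!%:R) *: 'X^j.
pose L := \sum_(1 <= r < k.+2) ((-1) ^+ r.-1 / r%:R) *: M ^+ r.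
rewrite -/M -/L.
have EM : egf k.+2 m = 1 + M.
  rewrite /egf poly_def -(big_mkord xpredT (fun i => (m i / i`!%:R) *: 'X^i)).
  by rewrite big_ltn // m0 fact0 divr1 expr0 scale1r.
have M0 : M`_0 = 0.
  have := congr1 (fun p : {poly R} => p`_0) EM.
  by rewrite coefD coef1 coef_egf // m0 fact0 divr1 /= -{1}[1]addr0 => /addrI.
have h1 : eqpX k.+1 (L^`()) (\poly_(i < k.+1) (kap i.+1 / i`!%:R)).
  apply: (@eqpX_mulI _ _ (1 + M));
    first by rewrite coefD M0 coef1 addr0 oner_neq0.
  rewrite mulrC deriv_formal_log.
  move: h; rewrite /cumulant_rel EM => h; apply: eqpX_trans h.
  rewrite derivD (_ : 1^`() = 0) ?add0r; last by rewrite -[1]/(1%:P) derivC.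
  rewrite -[X in eqpX _ _ X]mulr1.
  apply: eqpXM => //.
  have MX : M = 'X * \poly_(i < size M) M`_i.+1.
    by apply/polyP => -[|i]; rewrite coefXM //= coef_poly;
      case: ltnP => // /leqW /(nth_default 0).
  apply/eqpXP => i ik; rewrite coefB MX -mulrN exprMn coefXnM ik subr0 //.
have := (eqpXP _ _ _).1 h1 k (ltnSn k); rewrite coef_deriv coef_poly ltnSn.
rewrite -[L`_k.+1 *+ _]mulr_natr => Lk;
  rewrite factS natrM mulrAC [_ * L`__]mulrC Lk.
by rewrite divfK.
Qed.

Lemma cumulant_rel_leq n k m kap :
  (k <= n)%N -> cumulant_rel n m kap -> cumulant_rel k m kap.
Proof.
move=> kn /cumulant_relP h; apply/cumulant_relP => i ik; apply: h.
exact: leq_trans ik kn.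
Qed.

Lemma cumulant_rel_ext n m kap kap' :
  (forall k, (k < n)%N -> kap k.+1 = kap' k.+1) ->
  cumulant_rel n m kap -> cumulant_rel n m kap'.
Proof.
move=> kk /cumulant_relP h; apply/cumulant_relP => k kn; rewrite h //.
apply: eq_bigr => i _; rewrite kk // (leq_ltn_trans _ kn) // leq_subr //.
Qed.

(** The recursion can be solved for the cumulants one at a time, since
    m 0 = 1. *)
Lemma cumulant_rel_ex n m : m 0%N = 1 -> exists kap, cumulant_rel n m kap.
Proof.
move=> m0; elim: n => [|n [kap /cumulant_relP h]].
  by exists (fun=> 0); apply/cumulant_relP.
pose c := m n.+1 - n`!%:R * \sum_(i < n)
  m i.+1 / i.+1`!%:R * (kap (n - i.+1).+1 / (n - i.+1)`!%:R).
exists (fun k => if k == n.+1 then c else kap k).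
apply/cumulant_relP => k; rewrite ltnS leq_eqVlt => /predU1P[->|kn].
  rewrite big_ord_recl /= subn0 eqxx m0 fact0 divr1 mul1r.
  under eq_bigr => i _.
    rewrite /bump /= add1n eqSS ifN; last by rewrite neq_ltn;
      have := ltn_ord i; lia.
    over.
  by rewrite /c; field; exact: fact_neq0.
rewrite h //; apply: eq_bigr => i _; rewrite ifN //.
by rewrite eqSS neq_ltn (leq_ltn_trans (leq_subr _ _) kn).
Qed.

Lemma cumulant_rel_cumulant n m : m 0%N = 1 ->
  cumulant_rel n m (cumulant_seq m).
Proof.
move=> m0; have [kap h] := cumulant_rel_ex n m0.
apply: (cumulant_rel_ext _ h) => k kn; apply/esym/cumulant_seq_eq => //.
exact: cumulant_rel_leq h.
Qed.

Lemma cumulants_determine_moments m m' : m 0%N = 1 -> m' 0%N = 1 ->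
  (forall k, cumulant_seq m k.+1 = cumulant_seq m' k.+1) -> m =1 m'.
Proof.
move=> m0 m0' mm'; elim/ltn_ind => -[|k] IHk; first by rewrite m0.
have /cumulant_relP/(_ k (ltnSn k)) E := cumulant_rel_cumulant k.+1 m0.
have /cumulant_relP/(_ k (ltnSn k)) E' := cumulant_rel_cumulant k.+1 m0'.
have : m k.+1 / k`!%:R = m' k.+1 / k`!%:R.
  by rewrite E E'; apply: eq_bigr => i _; rewrite mm' IHk.
by move/divIf; apply.
Qed.

Lemma cumulant_rel_cvg n (m_ kap_ : nat -> nat -> R) m kap :
  (forall k, m_ ^~ k @ \oo --> m k) ->
  (forall k, (0 < k)%N -> kap_ ^~ k @ \oo --> kap k) ->
  (forall j, cumulant_rel n (m_ j) (kap_ j)) -> cumulant_rel n m kap.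
Proof.
move=> mc kc h; apply/cumulant_relP => k kn.
apply: (@cvg_unique _ (@Rhausdorff R) (m_ j k.+1 / k`!%:R @[j --> \oo])).
  by apply: cvgMr_tmp; exact: mc.
rewrite (_ : (fun j => m_ j k.+1 / k`!%:R) = fun j => \sum_(i < k.+1)
    m_ j i / i`!%:R * (kap_ j (k - i).+1 / (k - i)`!%:R)); last first.
  by apply/funext => j; exact: (cumulant_relP _ _ _).1 (h j) k kn.
apply: cvg_big => [|i _]; first exact: add_continuous.
apply: cvgM; first by apply: cvgMr_tmp; exact: mc.
by apply: cvgMr_tmp; exact: kc.
Qed.

End CumulantRecursion.

(** * The cumulants of the number of inversions *)

Section InversionCumulants.
Variables (R : realType) (T : rooted_tree) (c y : R).

Definition inversion_moment k : R := #|{: labelling T}|%:R^-1 *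
  \sum_(l : labelling T) (((inversions l)%:R - c) * y) ^+ k.

Definition inversion_cumulant k : R :=
  if k == 1%N then 0
  else bernoulli R k / k%:R * ((Upsilon T k)%:R - #|T|%:R) * y ^+ k.

Lemma card_labelling_gt0 : (0 < #|{: labelling T}|)%N.
Proof. by apply/card_gt0P; exists point. Qed.

Lemma inversion_moment0 : inversion_moment 0 = 1.
Proof.
rewrite /inversion_moment; under eq_bigr do rewrite expr0.
by rewrite sumr_const mulVf // pnatr_eq0 -lt0n card_labelling_gt0.
Qed.

Let e n := expm1X n y.

(** The generating function of the inversions evaluated at q = exp (y X).
    Multiplying each q-integer by (exp (y X) - 1) / X makes it
    (exp (z_v y X) - 1) / X. *)
Lemma inversion_egf n :
  eqpX n (egf n inversion_moment * \prod_(v : T) ((subtree_size v)%:R *: e n))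
    (exps n (- (c * y)) * \prod_(v : T) expm1X n ((subtree_size v)%:R * y)).
Proof.
pose q := exps n.+1 y; pose N : {poly R} := #|{: labelling T}|%:R.
have N0 : #|{: labelling T}|%:R != 0 :> R.
  by rewrite pnatr_eq0 -lt0n card_labelling_gt0.
have h1 : eqpX n (egf n inversion_moment)
    (#|{: labelling T}|%:R^-1 *:
      (exps n (- (c * y)) * \sum_(l : labelling T) q ^+ inversions l)).
  have -> : egf n inversion_moment =
      #|{: labelling T}|%:R^-1 *:
      \sum_(l : labelling T) exps n (((inversions l)%:R - c) * y).
    apply/polyP => k; rewrite coefZ coef_sum coef_poly.
    under [in RHS]eq_bigr do rewrite coef_poly.
    case: ifP => kn; last by rewrite big1 // mulr0.
    by rewrite -mulr_suml mulrA.
  rewrite -!mul_polyC; apply: eqpXM => //.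
  rewrite mulr_sumr; apply: eqpX_sum => l.
  rewrite mulrBl addrC; apply: eqpX_trans (eqpX_sym (expsD _ _ _)) _.
  apply: eqpXM => //; apply: eqpX_sym;
    apply: (@eqpX_trans _ _ (exps n.+1 (y *+ inversions l))).
    exact: eqpX_leq (expsX _ _ _).
  by apply/eqpXP => k kn; rewrite !coef_egf ?mulr_natl // ltnW.
apply: eqpX_trans (eqpXM h1 (@eqpX_refl _ _ _)) _.
rewrite -scalerAl -mulrA scalerAr.
apply: eqpXM => //.
have -> : \prod_(v : T) ((subtree_size v)%:R *: e n) =
   (\prod_(v : T) (subtree_size v)%:R) * \prod_(v : T) e n.
  by rewrite -big_split; apply: eq_bigr => v _; rewrite /= scaler_nat mulr_natl.
rewrite mulrCA mulrA inversions_gf -mulrA mulr_natl -[(_ * _) *+ _]scaler_nat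
  scalerA mulVf // scale1r.
rewrite -big_split /=; apply: eqpX_prod => v; rewrite mulrC;
  exact: geometric_exps.
Qed.

(** Each node contributes the difference of the logarithmic derivatives of
    (exp (z_v y X) - 1) / X and (exp (y X) - 1) / X. The constant terms are
    settled by the vanishing of the first moment. *)
Lemma inversion_cumulant_rel n : y != 0 -> inversion_moment 1 = 0 ->
  cumulant_rel n inversion_moment inversion_cumulant.
Proof.
move=> y0 m1.
have e0 : (\prod_(v : T) ((subtree_size v)%:R *: e n.+1))`_0 != 0.
  rewrite -horner_coef0 horner_prod prodf_seq_neq0; apply/allP => v _ /=.
  rewrite hornerZ horner_coef0 mulf_neq0 // ?pnatr_eq0 -?lt0n ?subtree_size_gt0
    //.
  by rewrite coef_poly /= expr1 divr1 y0.
have := log_deriv_div e0 (inversion_egf n.+1)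
  (log_deriv_prod _ (fun v => log_derivZ _ (expm1X_deriv n y)))
  (log_derivM (exps_deriv n _) (log_deriv_prod _ (fun v => expm1X_deriv n _))).
set d := (X in log_deriv _ _ X) => h.
have rel : cumulant_rel n inversion_moment (fun k => k.-1`!%:R * d`_k.-1).
  apply: eqpX_trans h _; apply: eqpXM => //; apply/eqpXP => k kn.
  by rewrite coef_poly kn /= mulrAC mulfV ?mul1r // pnatr_eq0 -lt0n fact_gt0.
apply: (cumulant_rel_ext _ rel) => -[n0|k kn] /=.
  have /(_ 0%N n0) := (cumulant_relP _ _ _).1 rel.
  by rewrite big_ord1 subnn fact0 !divr1 m1 inversion_moment0 mul1r.
rewrite /inversion_cumulant /= /d !coefB !coefD !coef_sum.
have coef_b a b : (bernX n a + b%:P)`_k.+1 =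
    bernoulli R k.+2 * a ^+ k.+2 / k.+2`!%:R :> R.
  by rewrite coefD coefC addr0 coef_poly kn.
under eq_bigr do rewrite coef_b.
under [X in _ - X]eq_bigr do rewrite coef_b.
rewrite coefC add0r sumr_const -mulr_suml.
under eq_bigr do rewrite exprMn mulrA.
rewrite -mulr_suml -mulr_sumr UpsilonE natr_sum.
under [in RHS]eq_bigr do rewrite natrX.
have f0 : k.+1`!%:R != 0 :> R by rewrite pnatr_eq0 -lt0n fact_gt0.
have k0 : k.+2%:R != 0 :> R by rewrite pnatr_eq0.
rewrite (factS k.+1) natrM -[_ *+ #|T|]mulr_natr.
move: (k.+1`!%:R : R) (k.+2%:R : R) f0 k0 => f g f0 g0.
by field; rewrite f0 g0.
Qed.

End InversionCumulants.

(** * The normalized number of inversions is subgaussian *)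

Section Subgaussian.
Variable R : realType.

(** For small x, exp x <= 1 / (1 - x) suffices; otherwise x is at most 2 x ^ 2
    in absolute value. *)
Lemma cosh_le (x : R) : expR x + expR (- x) <= 2 * expR (2 * x ^+ 2).
Proof.
have inv (u : R) : 0 < 1 - u -> expR u <= (1 - u)^-1.
  move=> u1; rewrite -[u in expR u]opprK expRN lef_pV2 ?posrE ?expR_gt0 //.
  exact: expR_ge1Dx.
have [x2|x2] := leP (x ^+ 2) 2^-1.
  have x1 : 0 < 1 - x by nra.
  have x1' : 0 < 1 - - x by nra.
  apply: le_trans (lerD (inv _ x1) (inv _ x1')) _.
  have -> : (1 - x)^-1 + (1 - - x)^-1 = 2 * (1 - x ^+ 2)^-1.
    by field; do ?[apply/andP; split]; apply: lt0r_neq0; nra.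
  rewrite ler_wpM2l // (le_trans _ (expR_ge1Dx _)) //.
  have x3 : 0 < 1 - x ^+ 2 by lra.
  by rewrite -div1r ler_pdivrMr //; nra.
rewrite (_ : 2 * _ = expR (2 * x ^+ 2) + expR (2 * x ^+ 2)); last by ring.
by apply: lerD; rewrite ler_expR; nra.
Qed.

(** By symmetry exp can be replaced with cosh, and the values are at most
    z / 2 in absolute value. *)
Lemma centered_uniform_mgf_le (t : R) z :
  \sum_(j < z) expR (t * (j%:R - (z%:R - 1) / 2)) <=
  z%:R * expR (t ^+ 2 * z%:R ^+ 2 / 2).
Proof.
pose a (j : nat) : R := t * (j%:R - (z%:R - 1) / 2).
have rev : \sum_(j < z) expR (a j) = \sum_(j < z) expR (- a j).
  rewrite (reindex_inj rev_ord_inj) /=; apply: eq_bigr => j _; congr expR.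
  by rewrite /a natrB // -[j.+1%:R]natr1; field.
rewrite -(ler_pM2l (ltr0n R 2)) mulr_natl mulr2n {2}rev -big_split /=.
rewrite mulrCA mulr_natl.
rewrite (_ : _ * expR _ *+ z = \sum_(j < z) 2 * expR (t ^+ 2 * z%:R ^+ 2 / 2));
  last first.
  by rewrite sumr_const card_ord.
apply: ler_sum => j _; apply: le_trans (cosh_le _) _.
rewrite ler_pM2l // ler_expR /a exprMn.
have : (j%:R : R) + 1 <= z%:R by rewrite natr1 ler_nat.
have : 0 <= (j%:R : R) by [].
move: (j%:R : R) (z%:R : R) => u w u0 uw.
have : (u - (w - 1) / 2) ^+ 2 <= w ^+ 2 / 4 by nra.
have := sqr_ge0 t; move: (t ^+ 2) ((u - (w - 1) / 2) ^+ 2) => T U T0 UT; nra.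
Qed.

Lemma sum_ord_nat n : \sum_(j < n) j%:R = n%:R * (n%:R - 1) / 2 :> R.
Proof.
elim: n => [|n IHn]; first by rewrite big_ord0 !mul0r.
by rewrite big_ord_recr /= IHn -natr1; field.
Qed.

End Subgaussian.

Section UniformLabelling.
Variables (R : realType) (T : rooted_tree).
Local Notation P := (uniform_labelling T R).
Local Notation X := (@normalized_inversions T R).
Local Notation N := (#|{: labelling T}|).

Lemma integral_uniform_labelling (f : labelling T -> R) :
  (\int[P]_l (f l)%:E = (N%:R^-1 * \sum_l f l)%:E)%E.
Proof.
have -> : [set: labelling T] =
  \big[setU/set0]_(l <- enum {: labelling T}) [set l].
  rewrite -bigcup_seq; apply/seteqP; split => // l _.
  by exists l => //=; rewrite mem_enum.
rewrite integral_bigsetU_EFin ?enum_uniq //; last first.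
  by apply/trivIsetP => i j _ _ ij; apply/seteqP; split => // x /= [-> /eqP];
    rewrite (negbTE ij).
rewrite mulr_sumr -sumEFin big_enum /=; apply: eq_bigr => l _.
rewrite (eq_integral (cst (f l)%:E)) => [|x]; last by rewrite inE => ->.
rewrite integral_cst // mulrC EFinM; congr (_ * _)%E.
exact: uniform_labelling1.
Qed.

Lemma integrable_uniform_labelling (f : labelling T -> R) :
  P.-integrable [set: labelling T] (EFin \o f).
Proof.
apply/integrableP; split => //.
under eq_integral do rewrite /= -?[(`|_|)%E]/((`|_|)%:E).
by rewrite integral_uniform_labelling ltry.
Qed.

Lemma integral_inversions_distribution (f : R -> R) :
  measurable_fun [set: R] f ->
  (\int[distribution P (X : {RV P >-> R})]_x (f x)%:E =
    (N%:R^-1 * \sum_l f (X l))%:E)%E.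
Proof.
move=> mf; rewrite integral_distribution.
- by rewrite -integral_uniform_labelling.
- exact/measurable_EFinP.
- exact: (integrable_uniform_labelling (f \o X)).
Qed.

Lemma mean_inversions_average :
  mean_inversions T R = N%:R^-1 * \sum_(l : labelling T) (inversions l)%:R.
Proof. by rewrite /mean_inversions unlock integral_uniform_labelling. Qed.

(** R_v has mean (z_v - 1) / 2. *)
Lemma mean_inversionsE :
  mean_inversions T R = \sum_(v : T) ((subtree_size v)%:R - 1) / 2.
Proof.
rewrite mean_inversions_average.
have N0 : N%:R != 0 :> R by rewrite pnatr_eq0 -lt0n card_labelling_gt0.
under eq_bigr do rewrite inversionsE natr_sum.
rewrite exchange_big /= mulr_sumr; apply: eq_bigr => v _.
have z0 : (subtree_size v)%:R != 0 :> R by rewrite pnatr_eq0 -lt0n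
  subtree_size_gt0.
have E : (subtree_size v)%:R * (\sum_l (rank_in l v v)%:R) =
    (\sum_(j < subtree_size v) j%:R) * N%:R :> R.
  rewrite -[N%:R]sumr_const -(@sum_rank_uniform T R v (fun=> 1) (fun j =>
    j%:R)) //.
  by under [in RHS]eq_bigr do rewrite mulr1.
apply: (mulfI z0); rewrite mulrCA E sum_ord_nat mulrCA mulVf // mulr1.
by rewrite mulrA.
Qed.

Local Notation s := (Num.sqrt (Upsilon T 2)%:R : R).

(** The contribution of the root alone. *)
Lemma Upsilon_ge k : (#|T| ^ k <= Upsilon T k)%N.
Proof. by rewrite UpsilonE (bigD1 (Defs.root T)) //= subtree_size_root
  leq_addr. Qed.

Lemma Upsilon2_gt0 : 0 < (Upsilon T 2)%:R :> R.
Proof.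
rewrite ltr0n (leq_trans _ (Upsilon_ge 2)) // expn_gt0.
by apply/orP; left; apply/card_gt0P; exists (Defs.root T).
Qed.

Lemma sqrt_Upsilon2_gt0 : 0 < s.
Proof. by rewrite sqrtr_gt0 Upsilon2_gt0. Qed.

Lemma moment_normalized_inversions k :
  moment (distribution P (X : {RV P >-> R})) k =
  inversion_moment T (mean_inversions T R) s^-1 k.
Proof.
by rewrite /moment unlock integral_inversions_distribution //;
  exact: exprn_measurable.
Qed.

Lemma inversion_moment1 : inversion_moment T (mean_inversions T R) s^-1 1 = 0.
Proof.
have N0 : N%:R != 0 :> R by rewrite pnatr_eq0 -lt0n card_labelling_gt0.
rewrite /inversion_moment; under eq_bigr do rewrite expr1.
rewrite -mulr_suml sumrB sumr_const mulrA mulrBr.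
rewrite -[mean_inversions T R *+ _]mulr_natr mulrCA mulVf // mulr1.
by rewrite mean_inversions_average subrr mul0r.
Qed.

(** The exponential is a product over the nodes, to which independence of the
    ranks applies; the sum of the z_v ^ 2 is the square of the normalizing
    factor. *)
Lemma mgf_normalized_inversions_le t :
  (\int[distribution P (X : {RV P >-> R})]_x (expR (t * x))%:E <=
    (expR (t ^+ 2 / 2))%:E)%E.
Proof.
rewrite integral_inversions_distribution; last first.
  by apply: measurableT_comp => //; exact: mulrl_measurable.
rewrite lee_fin.
have N0 : 0 < N%:R :> R by rewrite ltr0n card_labelling_gt0.
rewrite ler_pdivrMl //.
have Z0 : 0 < \prod_(v : T) (subtree_size v)%:R :> R.
  by apply: prodr_gt0 => v _; rewrite ltr0n subtree_size_gt0.
rewrite -(ler_pM2l Z0).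
pose g (v : T) (j : nat) :=
  expR (t / s * (j%:R - ((subtree_size v)%:R - 1) / 2)).
have -> : \sum_l expR (t * X l) =
  \sum_(l : labelling T) \prod_v g v (rank_in l v v).
  apply: eq_bigr => l _; rewrite /g -expR_sum -mulr_sumr sumrB -natr_sum.
  by rewrite -inversionsE -mean_inversionsE mulrA mulrAC -mulrA.
rewrite sum_prod_rank_uniform mulrCA ler_wpM2l //.
have -> : expR (t ^+ 2 / 2) =
    \prod_(v : T) expR ((t / s) ^+ 2 * (subtree_size v)%:R ^+ 2 / 2).
  rewrite -expR_sum -mulr_suml -mulr_sumr; congr expR; congr (_ / _).
  have -> : \sum_(v : T) (subtree_size v)%:R ^+ 2 = s ^+ 2 :> R.
    rewrite sqr_sqrtr ?(ltW Upsilon2_gt0) // UpsilonE natr_sum.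
    by apply: eq_bigr => v _; rewrite natrX.
  by rewrite -exprMn divfK // gt_eqF // sqrt_Upsilon2_gt0.
rewrite -big_split /=; apply: ler_prod => v _; apply/andP; split.
  by apply: sumr_ge0 => j _; exact: expR_ge0.
exact: centered_uniform_mgf_le.
Qed.

End UniformLabelling.

(** * Extraction of subsequences and quantile functions *)

(** The sequence lives in a product of segments, which is compact; around a
    cluster point, the basic neighbourhoods constraining the first j
    coordinates form a sequence because I is countable. *)
Lemma diagonal_extraction (R : realType) (I : countType)
    (a : nat -> I -> R) (B : I -> R) :
  (forall n i, `|a n i| <= B i) ->
  exists phi : nat -> nat, exists L : I -> R,
    (forall j, (j <= phi j)%N) /\ (forall i, a (phi j) i @[j --> \oo] --> L i).
Proof.
move=> aB.
have cK := @tychonoff I (fun=> R) (fun i => `[- B i, B i]%classic)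
  (fun i => @segment_compact R (- B i) (B i)).
have FF : ProperFilter (a @ \oo) by exact: fmap_proper_filter.
have [|L [_ cL]] := cK (a @ \oo) FF.
  by exists 0%N => // n _ i /=; rewrite in_itv /= -ler_norml.
have pick j : exists n, (j <= n)%N /\
    forall i, (pickle i <= j)%N -> `|L i - a n i| < j.+1%:R^-1.
  pose W (k : 'I_j.+1) (f : {ptws I -> R}) : Prop :=
    if unpickle k is Some i return Prop then `|L i - f i| < j.+1%:R^-1 else
      True.
  pose V := [set f : {ptws I -> R} | forall k, W k f].
  have nV : nbhs (L : {ptws I -> R}) V.
    have FL : Filter (nbhs (L : {ptws I -> R})) by exact: nbhs_filter.
    apply: (@filter_forall _ _ W _ FL) => k; rewrite /W.
    case: (unpickle k) => [i|]; last exact: filterT.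
    have /cvgrPdist_lt := @proj_continuous I (fun=> R) i L.
    by apply; rewrite invr_gt0.
  have [] := cL (a @` [set n | (j <= n)%N]) V _ nV.
    by exists j => // n /= jn; exists n.
  move=> f [[n /= jn <-] Vn]; exists n; split=> // i ij.
  by have := Vn (Ordinal (ij : (pickle i < j.+1)%N)); rewrite /W /= pickleK.
have [phi phiP] := choice pick.
exists phi, L; split=> [j|i]; first by have [] := phiP j.
apply/cvgrPdist_lt => e e0.
have := near_infty_natSinv_lt (PosNum e0); apply: filter_app.
exists (pickle i) => // j /= ij; apply: lt_trans.
by have [_] := phiP j; exact.
Qed.

Section Quantile.
Variables (R : realType) (nu : probability R R).

(** The generalized inverse of the distribution function; 0 off ]0, 1[ to be
    total. *)
Definition quantile (u : R) : R :=
  if 0 < u < 1 then inf [set x | (u%:E <= nu `]-oo, x]%classic)%E] else 0.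

HB.instance Definition _ :=
  @isMeasurableFun.Build _ _ R R idfun (@measurable_id _ R setT).

(** The Galois connection between quantiles and distribution function; it
    rests on the right continuity of the latter. *)
Lemma quantile_leP u x : 0 < u < 1 ->
  (quantile u <= x) <-> (u%:E <= nu `]-oo, x]%classic)%E.
Proof.
move=> u01; rewrite /quantile u01; have /andP[u0 u1] := u01.
pose X : {RV nu >-> R} := (idfun : R -> R).
have cX r : cdf X r = nu `]-oo, r]%classic by [].
set S := [set x | _].
have SE r : S r <-> u <= fine (cdf X r).
  by rewrite /S /= -cX -[in X in X <-> _](@fineK _ (cdf X r)) ?fin_num_measure.
have Fnd : {homo (fun r => fine (cdf X r)) : r r' / r <= r'}.
  by move=> r r' rr; rewrite fine_le ?fin_num_measure // cdf_nondecreasing.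
have S0 : S !=set0.
  have /fine_cvg/cvgr_gt/(_ u u1) := @cvg_cdfy1 _ _ _ _ X.
  by move=> /filter_ex[r /= ur]; exists r; apply/SE; exact: ltW.
have lS : has_lbound S.
  have /fine_cvg/cvgr_lt/(_ u u0) := @cvg_cdfNy0 _ _ _ _ X.
  move=> /filter_ex[r /= ur]; exists r => r' /SE ur'; rewrite leNgt.
  by apply/negP => /ltW/Fnd; have := le_lt_trans ur' ; lra.
split=> [Qx|ux]; last by apply: ge_inf.
have := @cdf_right_continuous _ _ _ _ X x; move/cvge_to_ge; apply.
near=> r; have [|r' Sr' rr'] := @inf_adherent _ S (r - inf S) _ (conj S0 lS).
  by rewrite subr_gt0 (le_lt_trans Qx).
rewrite addrCA subrr addr0 in rr'.
by apply: (le_trans Sr'); rewrite -cX cdf_nondecreasing // ltW.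
Unshelve. all: by end_near. Qed.

Lemma quantile_nondecreasing u v :
  0 < u -> u <= v -> v < 1 -> quantile u <= quantile v.
Proof.
move=> u0 uv v1; apply/quantile_leP; first by rewrite u0 (le_lt_trans uv).
apply: (@le_trans _ _ v%:E); first by rewrite lee_fin.
by apply/quantile_leP => //; rewrite v1 (lt_le_trans u0).
Qed.

Lemma measurable_quantile :
  measurable_fun [set: measurableTypeR R] (quantile : measurableTypeR R -> R).
Proof.
pose F r := fine (nu `]-oo, r]%classic).
move=> mD; apply: (measurability _ (RGenOInfty.measurableE R)) => //.
move=> _ [_ [x ->] <-]; rewrite setTI.
have -> : quantile @^-1` `]x, +oo[ =
    (`]0, 1[ `&` `]F x, +oo[) `|` (~` `]0, 1[ `&` [set _ | x < 0]).
  apply/seteqP; split=> u /=; rewrite !in_itv /= !andbT.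
    have [u01|u01] := boolP (0 < u < 1);
      last by rewrite /quantile (negbTE u01); right.
    rewrite ltNge => /negP h; left; split => //; rewrite ltNge;
      apply/negP => uF; apply: h.
    by apply/quantile_leP => //; rewrite -(@fineK _ (nu _)) ?fin_num_measure.
  move=> [[u01 Fu]|[/negP u01 x0]]; last by rewrite /quantile (negbTE u01).
  rewrite ltNge; apply/negP => /(quantile_leP _ u01).
  by rewrite -(@fineK _ (nu _)) ?fin_num_measure // lee_fin leNgt Fu.
apply: measurableU; first exact: measurableI.
apply: measurableI; first exact: measurableC.
by case: (x < 0); [rewrite (_ : [set _ | _] = setT)|rewrite (_ : [set _ | _] =
  set0)];
  rewrite // predeqE.
Qed.

(** The quantile function as a random variable on [measurableTypeR R], the
    carrier of the uniform law. *)
Definition quantile_var : measurableTypeR R -> R := quantile.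

HB.instance Definition _ :=
  @isMeasurableFun.Build _ _ (measurableTypeR R) R quantile_var
    measurable_quantile.

End Quantile.

Section CdfUnique.
Variable R : realType.

Lemma cdf_unique (mu nu : probability R R) :
  (forall x, mu `]-oo, x]%classic = nu `]-oo, x]%classic) ->
  forall A, measurable A -> mu A = nu A.
Proof.
move=> cdfE A mA.
pose G : set (set R) := [set B | exists x, B = `]-oo, x]%classic].
apply: (measure_unique G (fun n => `]-oo, n%:R]%classic)) => //.
- apply/seteqP; split => [B mB|].
    have /= := mB; rewrite [X in X B -> _]RGenOInfty.measurableE.
    move: B {mB}; apply: smallest_sub; first exact: smallest_sigma_algebra.
    move=> _ [x ->]; rewrite -setCitvl.
    have [_ compl _] := @smallest_sigma_algebra _ setT G.
    by rewrite -setTD; apply: compl; apply: sub_gen_smallest; exists x.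
  apply: smallest_sub; first exact: sigma_algebra_measurable.
  by move=> _ [x ->] /=; exact: measurable_itv.
- move=> _ _ [x ->] [y ->]; exists (Num.min x y).
  by apply/seteqP; split=> z /=; rewrite !in_itv /= le_min => /andP.
- by move=> n; exists n%:R.
- apply/seteqP; split=> // x _; exists (Num.bound `|x|) => //=.
  by rewrite in_itv /= ltW // (le_lt_trans (ler_norm _)) // archi_boundP.
- by move=> _ [x ->]; exact: cdfE.
- by move=> n; apply: (@le_lt_trans _ _ 1%E); rewrite ?ltry // probability_le1.
Qed.

Definition uniform01 : probability (measurableTypeR R) R :=
  uniform_prob (@ltr01 R).

Lemma uniform01_itv c : 0 <= c <= 1 -> uniform01 `]-oo, c]%classic = c%:E.
Proof.
move=> /andP[c0 c1]; rewrite /uniform01 /= /uniform_prob integral_uniform_pdf.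
have -> : `]-oo, c] `&` `[0%R, 1%R] = `[0%R, c]%classic :> set R.
  apply/seteqP; split=> x /=; rewrite !in_itv /=;
    first by move=> [? /andP[-> _]].
  by move=> /andP[-> xc]; split => //; rewrite (le_trans xc).
rewrite (eq_integral (cst 1%E)) => [|x]; last first.
  rewrite inE /= in_itv /= /uniform_pdf => /andP[-> xc].
  by rewrite (le_trans xc) // subr0 invr1.
rewrite integral_cst // mul1e; apply: etrans (lebesgue_measure_itv _) _.
by rewrite /= lte_fin; case: ltgtP c0 => // [_ _|<- _]; rewrite ?sube0.
Qed.

Lemma uniform01_boundary : uniform01 (~` `]0, 1[%classic) = 0%E.
Proof.
rewrite /uniform01 /= /uniform_prob integral_uniform_pdf.
apply: null_set_integral; first by apply: measurableI => //; exact: measurableC.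
  by apply/measurable_EFinP; apply: measurable_funTS;
    exact: measurable_uniform_pdf.
apply: countable_lebesgue_measure0.
apply: (@sub_countable _ _ _ [set 0; 1]);
  last exact/finite_set_countable/finite_set2.
apply: subset_card_le => x /= [+ /[!in_itv] /= /andP[x0 x1]].
move=> /negP; rewrite negb_and -!leNgt => /orP[xl|xl].
  by left; apply/eqP; rewrite eq_le xl x0.
by right; apply/eqP; rewrite eq_le xl x1.
Qed.

Lemma uniform01_eq (A B : set (measurableTypeR R)) : measurable A ->
  measurable B ->
  (forall u : R, 0 < u < 1 -> A u <-> B u) -> uniform01 A = uniform01 B.
Proof.
move=> mA mB AB.
pose N : set (measurableTypeR R) := ~` `]0, 1[%classic.
have mN : measurable N by exact: measurableC.
have /(null_setU uniform01 mN) NU : uniform01.-null_set N.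
  by move=> C mC CN; exact: subset_measure0 CN uniform01_boundary.
rewrite -(NU A) // -(NU B) //; congr (uniform01 _).
apply/seteqP; split=> u [|?]; [|by right| |by right].
  have [/AB h /h|u01] := boolP (0 < u < 1); first by left.
  by right; rewrite /N /= in_itv /=; exact/negP.
have [/AB h /h|u01] := boolP (0 < u < 1); first by left.
by right; rewrite /N /= in_itv /=; exact/negP.
Qed.

(** Inverse transform sampling: by [quantile_leP] both laws have the same
    distribution function. *)
Lemma distribution_quantile (nu : probability R R) A : measurable A ->
  distribution uniform01 (quantile_var nu : {RV uniform01 >-> R}) A = nu A.
Proof.
move: A; apply: cdf_unique => x.
pose F := fine (nu `]-oo, x]%classic).
have FE : nu `]-oo, x]%classic = F%:E by rewrite fineK ?fin_num_measure.
have F01 : 0 <= F <= 1.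
  by rewrite -!lee_fin -FE measure_ge0 probability_le1.
rewrite FE -uniform01_itv // /distribution /pushforward /=.
apply: uniform01_eq => // [|u u01].
  rewrite -[X in measurable X]setTI; exact: measurable_quantile.
rewrite /= !in_itv /=; apply: iff_trans (quantile_leP nu x u01) _.
by rewrite FE lee_fin.
Qed.

End CdfUnique.

(** * Tight sequences have weakly convergent subsequences *)

(** Where q j u does not converge, the limits L at the rationals jump; sending
    u to a rational inside the gap is injective because the gaps do not
    overlap. *)
Lemma monotone_cvg_countable (R : realType) (q : nat -> R -> R) (L : rat -> R) :
  (forall j u v, 0 < u -> u <= v -> v < 1 -> q j u <= q j v) ->
  (forall r : rat, q j (ratr r) @[j --> \oo] --> L r) ->
  countable [set u : R | 0 < u < 1 /\ ~ cvg (q j u @[j --> \oo])].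
Proof.
move=> qnd qL; set Bad := [set u | _].
pose gap (u : R) (rho : rat) :=
  (forall r : rat, 0 < (ratr r : R) < u -> L r < ratr rho) /\
  (forall r : rat, u < (ratr r : R) < 1 -> ratr rho <= L r).
have gapP u : exists rho, Bad u -> gap u rho.
  have [[u01 ncv]|nB] := pselect (Bad u); last by exists 0.
  have /andP[u0 u1] := u01.
  pose S1 := [set L r | r in [set r : rat | 0 < (ratr r : R) < u]].
  pose S2 := [set L r | r in [set r : rat | u < (ratr r : R) < 1]].
  have LL r r' : 0 < (ratr r : R) < u -> u < (ratr r' : R) < 1 -> L r <= L r'.
    move=> /andP[r0 ru] /andP[ur' r1]; apply: ler_cvg_to (qL r) (qL r') _.
    by apply: nearW => j; apply: qnd => //; rewrite ltW // (lt_trans ru).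
  have [r1 r1P] : exists r : rat, 0 < (ratr r : R) < u.
    by have [r] := rat_in_itvoo u0; rewrite in_itv; exists r.
  have [r2 r2P] : exists r : rat, u < (ratr r : R) < 1.
    by have [r] := rat_in_itvoo u1; rewrite in_itv; exists r.
  have hS1 : has_sup S1.
    split; first by exists (L r1), r1.
    by exists (L r2) => _ [r rP <-]; exact: LL.
  have hS2 : has_inf S2.
    split; first by exists (L r2), r2.
    by exists (L r1) => _ [r rP <-]; exact: LL.
  have [lh|hl] := ltP (sup S1) (inf S2).
    have [rho] := rat_in_itvoo lh; rewrite in_itv /= => /andP[lr rh].
    exists rho => _; split => r rP.
      by apply: le_lt_trans lr; apply: ub_le_sup; [case: hS1|exists r].
    by apply: (le_trans (ltW rh)); apply: ge_inf; [case: hS2|exists r].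
  exfalso; apply: ncv; apply/cvg_ex; exists (sup S1).
  apply/cvgrPdist_lt => e e0.
  have [_ [r rP <-] rl] := sup_adherent e0 hS1.
  have [_ [r' rP' <-] rh] := inf_adherent e0 hS2.
  have /andP[r_gt0 r_lt] := rP; have /andP[r'_gt r'_lt1] := rP'.
  near=> j.
  have h1 : sup S1 - e < q j (ratr r).
    by near: j; exact: (cvgr_gt (L r)).
  have h2 : q j (ratr r') < inf S2 + e.
    by near: j; exact: (cvgr_lt (L r')).
  have h3 : q j (ratr r) <= q j u by apply: qnd => //; exact: ltW.
  have h4 : q j u <= q j (ratr r') by apply: qnd => //; exact: ltW.
  by rewrite ltr_norml; apply/andP; split; lra.
(* Any rational between u < v separates the gaps at u and at v. *)
have [rho rhoP] := choice gapP.
apply/countable_injP; exists (pickle \o rho) => u v; rewrite !inE => Bu Bv /=.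
move=> /(pcan_inj (@pickleK _)) uv.
have key x y : Bad x -> Bad y -> rho x = rho y -> x < y -> False.
  move=> Bx By xy xly; have [r] := rat_in_itvoo xly;
    rewrite in_itv /= => /andP[xr ry].
  have [/andP[x0 _] _] := Bx; have [/andP[_ y1] _] := By.
  have [_ /(_ r)] := rhoP x Bx; rewrite xr (lt_trans ry) // => /(_ isT) h1.
  have [/(_ r) + _] := rhoP y By; rewrite ry (lt_trans x0) // => /(_ isT).
  by rewrite -xy ltNge h1.
have [uv'|uv'|//] := ltgtP u v; exfalso; first exact: (key u v).
exact: (key v u).
Unshelve. all: by end_near. Qed.

Section Helly.
Variable R : realType.

Lemma uniform01_countable (A : set R) : countable A -> uniform01 R A = 0%E.
Proof.
move=> cA; have mA : measurable A by exact: countable_measurable.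
rewrite /uniform01 /= /uniform_prob integral_uniform_pdf.
apply: null_set_integral; first exact: measurableI.
  by apply/measurable_EFinP; apply: measurable_funTS;
    exact: measurable_uniform_pdf.
apply: countable_lebesgue_measure0; apply: sub_countable cA.
by apply: subset_card_le => x [].
Qed.

Definition tight (nu_ : nat -> probability R R) := forall e : R, 0 < e ->
  exists A : R, forall n, ((1 - e)%:E <= nu_ n `[(- A)%R, A]%classic)%E.

(** If all laws have mass more than max (u, 1 - u) on [- A, A], then their
    quantiles at u lie there. *)
Lemma tight_quantile_bounded nu_ u :
  tight nu_ -> exists B, forall n, `|quantile (nu_ n) u| <= B.
Proof.
move=> tnu; have [u01|u01] := boolP (0 < u < 1); last first.
  by exists 0 => n; rewrite /quantile (negbTE u01) normr0.
have /andP[u0 u1] := u01.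
have e0 : 0 < Num.min u (1 - u) / 2 by rewrite divr_gt0 // lt_min u0 subr_gt0.
have [A AP] := tnu _ e0.
have e1 : Num.min u (1 - u) / 2 < u by rewrite ltr_pdivrMr // gt_min;
  apply/orP; left; lra.
have e2 : Num.min u (1 - u) / 2 < 1 - u by rewrite ltr_pdivrMr // gt_min;
  apply/orP; right; lra.
exists (`|A| + 1) => n; rewrite ler_norml.
have A1 := ler_norm A; have A2 := ler_norm (- A); rewrite normrN in A2.
apply/andP; split.
  apply/ltW; rewrite ltNge; apply/negP => /(quantile_leP _ _ u01) h.
  have : (nu_ n (`]-oo, (- (`|A| + 1))%R]%classic `|` `[(- A)%R, A]%classic) <=
    1)%E.
    by apply: probability_le1; exact: measurableU.
  rewrite measureU //; last first.
    apply/seteqP; split=> // x /= [] /[!in_itv] /=; lra.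
  move=> /(le_trans (leeD h (AP n))); rewrite -EFinD lee_fin; lra.
apply/(quantile_leP _ _ u01).
apply: (@le_trans _ _ (1 - Num.min u (1 - u) / 2)%:E);
  first by rewrite lee_fin; lra.
apply: (le_trans (AP n)); apply: le_measure; rewrite ?inE //.
by move=> x /=; rewrite !in_itv /=; lra.
Qed.

(** Helly's selection theorem, on quantile functions instead of distribution
    functions: a subsequence of them converges at all rationals, hence off a
    countable set, and the limit G transports the uniform law to the weak
    limit by dominated convergence. *)
Theorem tight_subsequence (nu_ : nat -> probability R R) : tight nu_ ->
  exists phi : nat -> nat, exists mu : probability R R,
    (forall j, (j <= phi j)%N) /\ cvg_in_distribution (fun j => nu_ (phi j)) mu.
Proof.
move=> tnu.
have [B BP] := choice (fun r : rat => tight_quantile_bounded (ratr r) tnu).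
have [phi [L [phij phiL]]] := diagonal_extraction (fun n r => BP r n).
pose q j u := quantile (nu_ (phi j)) u.
have cB := @monotone_cvg_countable R q L
  (fun j u v u0 uv v1 => quantile_nondecreasing (nu_ (phi j)) u0 uv v1) phiL.
set Bad := [set u | _] in cB.
pose G (u : measurableTypeR R) : R := fine (limn_esup (fun j => (q j u)%:E)).
have mG : measurable_fun [set: measurableTypeR R] G.
  apply: measurableT_comp; first exact: fine_measurable.
  apply: measurable_fun_limn_esup => j; apply/measurable_EFinP.
  exact: measurable_quantile.
pose GX : {RV (uniform01 R) >-> R} :=
  HB.pack G (@isMeasurableFun.Build _ _ _ _ G mG).
have GE u : 0 < u < 1 -> ~ Bad u -> q j u @[j --> \oo] --> G u.
  move=> u01 nB; have cq : cvg (q j u @[j --> \oo]).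
    by apply: contrapT => ncv; apply: nB.
  have h : (q j u)%:E @[j --> \oo] --> (lim (q j u @[j --> \oo]))%:E.
    by apply: cvg_EFin; [exact: nearW|].
  rewrite /G is_cvg_limn_esupE; last by apply/cvg_ex; eexists; exact: h.
  by rewrite (cvg_lim _ h).
exists phi, (distribution (uniform01 R) GX); split => // f cf bf.
have mf : measurable_fun [set: R] f by exact: continuous_measurable_fun.
have [M [Mreal fM]] := bf.
have fb x : `|f x| <= M + 1 by apply: (fM (M + 1)) => //; rewrite ltrDl.
have intf (h : measurableTypeR R -> R) :
    measurable_fun setT h -> (uniform01 R).-integrable setT (EFin \o (f \o h)).
  move=> mh; apply: measurable_bounded_integrable => //.
  - by rewrite (le_lt_trans (probability_le1 _ _)) ?ltry.
  - exact: measurableT_comp.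
  - by exists (M + 1); split => [|y My x _];
    [rewrite num_real|exact: le_trans (fb _) (ltW My)].
have E j : (\int[nu_ (phi j)]_x (f x)%:E =
  \int[uniform01 R]_u (f (q j u))%:E)%E.
  transitivity (\int[distribution (uniform01 R)
      (quantile_var (nu_ (phi j)) : {RV (uniform01 R) >-> R})]_x (f x)%:E)%E.
    by apply: eq_measure_integral => A mA _; apply/esym;
      exact: distribution_quantile.
  rewrite integral_distribution //; first exact/measurable_EFinP.
  by apply: intf; exact: measurable_quantile.
under eq_cvg do rewrite E.
rewrite integral_distribution //; [|exact/measurable_EFinP|exact: intf].
have [|||||_ _ +] := @dominated_convergence _ _ _ (uniform01 R) setT measurableT
  (fun j u => (f (q j u))%:E) (fun u => (f (G u))%:E) (cst (M + 1)%:E).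
- by move=> j; apply/measurable_EFinP; apply: measurableT_comp => //;
  exact: measurable_quantile.
- by apply/measurable_EFinP; exact: measurableT_comp.
- have n1 : (uniform01 R).-negligible (Bad : set (measurableTypeR R)).
    by apply/negligibleP; [exact: countable_measurable|exact:
      uniform01_countable].
  have n2 : (uniform01 R).-negligible (~` `]0, 1[%classic : set
    (measurableTypeR R)).
    by apply/negligibleP; [exact: measurableC|exact: uniform01_boundary].
  apply: negligibleS (negligibleU n1 n2) => u /= ncv.
  have [u01|u01] := boolP (0 < u < 1); last by right; rewrite in_itv /=;
    exact/negP.
  left; apply: contrapT => nB; apply: ncv => _.
  apply: cvg_EFin; first exact: nearW.
  exact: (continuous_cvg _ (cf (G u)) (GE u u01 nB)).
- by apply: finite_measure_integrable_cst.
- by apply: aeW => u j _ /=; rewrite lee_fin.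
- by [].
Qed.

End Helly.

(** * Moments determine a law with exponential moments *)

Section Peak.
Variable R : realType.

(** With w the square root of z, n * w ^ n stays bounded by 1 / (1 - w), by
    comparison with the geometric series. *)
Lemma natmul_expr_cvg0 (z : R) : 0 <= z < 1 ->
  n%:R * z ^+ n @[n --> \oo] --> (0 : R).
Proof.
move=> /andP[z0 z1]; pose w := Num.sqrt z.
have w0 : 0 <= w by exact: sqrtr_ge0.
have w1 : w < 1 by rewrite -sqrtr1 ltr_sqrt.
have wb n : n%:R * w ^+ n <= (1 - w)^-1.
  rewrite -div1r ler_pdivlMr ?subr_gt0 //.
  have -> : n%:R * w ^+ n * (1 - w) = (1 - w) * \sum_(i < n) w ^+ n.
    by rewrite sumr_const card_ord -[_ *+ n]mulr_natl; ring.
  apply: (@le_trans _ _ ((1 - w) * \sum_(i < n) w ^+ i)).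
    rewrite ler_wpM2l ?subr_ge0 ?(ltW w1) //; apply: ler_sum => i _.
    by rewrite ler_wiXn2l ?(ltW w1) // ltnW.
  rewrite -opprB mulNr -subrX1 opprB gerBl exprn_ge0 //.
have zw n : z ^+ n = w ^+ n * w ^+ n by rewrite -exprMn -expr2 sqr_sqrtr.
have lim0 : w ^+ n * (1 - w)^-1 @[n --> \oo] --> (0 : R).
  by rewrite -[X in _ --> X](mul0r (1 - w)^-1); apply: cvgMr_tmp;
    apply: cvg_expr; rewrite ger0_norm.
apply: (squeeze_cvgr _ (cvg_cst 0) lim0); apply: nearW => n.
by rewrite mulr_ge0 ?exprn_ge0 //= zw mulrCA ler_wpM2l ?exprn_ge0.
Qed.

Lemma bernoulli_inequality (w : R) m : 0 <= w <= 1 ->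
  1 - m%:R * w <= (1 - w) ^+ m.
Proof.
move=> /andP[w0 w1]; elim: m => [|m IHm]; first by rewrite mul0r subr0 expr0.
rewrite exprS; apply: (@le_trans _ _ ((1 - w) * (1 - m%:R * w))).
  rewrite -natr1; have : 0 <= m%:R * w * w by rewrite !mulr_ge0.
  lra.
by rewrite ler_wpM2l // subr_ge0.
Qed.

(** The exponent n * 2 ^ n, rather than 2 ^ n, makes the limit 0 also at y = 1
    / 2. *)
Lemma peak_cvg (y : R) : 0 <= y <= 1 ->
  (1 - y ^+ n) ^+ (n * 2 ^ n) @[n --> \oo] --> ((y < 2^-1)%R%:R : R).
Proof.
move=> /andP[y0 y1].
have h01 n : 0 <= 1 - y ^+ n <=
  1 by rewrite subr_ge0 exprn_ile1 //= gerBl exprn_ge0.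
have [ylt|yge] := ltP y 2^-1.
  rewrite [X in _ --> X](_ : _ = (1 : R)) //.
  have lim1 : 1 - n%:R * (2 * y) ^+ n @[n --> \oo] --> (1 : R).
    rewrite -[X in _ --> X]subr0; apply: cvgB; first exact: cvg_cst.
    by apply: natmul_expr_cvg0; rewrite mulr_ge0 //=; lra.
  apply: (squeeze_cvgr _ lim1 (cvg_cst (1 : R))); apply: nearW => n.
  have /andP[h0 h1] := h01 n; rewrite exprn_ile1 // andbT.
  apply: le_trans (bernoulli_inequality _ _);
    last by rewrite exprn_ge0 ?exprn_ile1.
  by rewrite natrM natrX exprMn mulrA.
rewrite [X in _ --> X](_ : _ = (0 : R)) //.
have lim0 : expR (-1) ^+ n @[n --> \oo] --> (0 : R).
  by apply: cvg_expr; rewrite ger0_norm ?expR_ge0 // -expR0 ltr_expR; lra.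
apply: (squeeze_cvgr _ (cvg_cst 0) lim0); apply: nearW => n.
have /andP[h0 h1] := h01 n; rewrite exprn_ge0 //=.
apply: (@le_trans _ _ (expR (- y ^+ n) ^+ (n * 2 ^ n))).
  by rewrite lerXn2r ?nnegrE ?expR_ge0 //; exact: expR_ge1Dx.
(* The exponent - y ^ n * n * 2 ^ n is at most - n, since 2 y >= 1. *)
rewrite -!expRM_natl ler_expR mulrN1 mulrN lerN2 natrM natrX -mulrA -exprMn.
by rewrite ler_peMr // exprn_ege1 //; lra.
Qed.

End Peak.

Section Agreement.
Variables (R : realType) (mu nu : probability R R).

(** The bounded test functions that do not separate mu from nu. *)
Record agree (f : R -> R) : Prop := Agree {
  agree_measurable : measurable_fun [set: R] f;
  agree_bounded : exists M, forall x, `|f x| <= M;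
  agree_integral : (\int[mu]_x (f x)%:E = \int[nu]_x (f x)%:E)%E }.

Lemma bounded_integrable (P : probability R R) (f : R -> R) :
  measurable_fun [set: R] f -> (exists M, forall x, `|f x| <= M) ->
  P.-integrable [set: R] (EFin \o f).
Proof.
move=> mf [M fM]; apply: measurable_bounded_integrable => //.
  by apply: (@le_lt_trans _ _ 1%E); rewrite ?ltry // probability_le1.
by exists M; split => [|y My x _];
  [rewrite num_real|exact: le_trans (fM _) (ltW My)].
Qed.

Lemma agree_integrable f : agree f ->
  mu.-integrable [set: R] (EFin \o f) /\ nu.-integrable [set: R] (EFin \o f).
Proof. by move=> [mf bf _]; split; exact: bounded_integrable. Qed.

Lemma agreeD f g : agree f -> agree g -> agree (fun x => f x + g x).
Proof.
move=> /[dup] /agree_integrable[imf inf] [mf [M fM] ef].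
move=> /[dup] /agree_integrable[img ing] [mg [N gN] eg]; split.
- exact: measurable_funD.
- by exists (M + N) => x; rewrite (le_trans (ler_normD _ _)) // lerD.
- under eq_integral do rewrite EFinD;
  rewrite integralD //= ef eg -integralD //=.
Qed.

Lemma agreeZ c f : agree f -> agree (fun x => c * f x).
Proof.
move=> /[dup] /agree_integrable[imf inf] [mf [M fM] ef]; split.
- exact: measurable_funM.
- by exists (`|c| * M) => x; rewrite normrM ler_wpM2l.
- by under eq_integral do rewrite EFinM; rewrite integralZl //= ef -integralZl.
Qed.

Lemma agree_cst c : agree (fun=> c).
Proof.
split; first exact: measurable_cst.
  by exists `|c| => x; exact: lexx.
rewrite !integral_cst //; congr (_ * _)%E.
exact: etrans (probability_setT mu) (esym (probability_setT nu)).
Qed.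

Lemma agree_sum n (f : nat -> R -> R) : (forall i, agree (f i)) ->
  agree (fun x => \sum_(i < n) f i x).
Proof.
move=> af; elim: n => [|n IHn].
  by rewrite (_ : (fun _ => _) = fun=> 0); [exact: agree_cst|apply/funext => x;
    rewrite big_ord0].
rewrite (_ : (fun _ => _) = fun x => \sum_(i < n) f i x + f n x).
  exact: agreeD.
by apply/funext => x; rewrite big_ord_recr.
Qed.

Lemma agree_lim (f_ : nat -> R -> R) (f : R -> R) M :
  (forall n, agree (f_ n)) -> (forall n x, `|f_ n x| <= M) ->
  (forall x, f_ n x @[n --> \oo] --> f x) -> agree f.
Proof.
move=> af fM fc.
have mf : measurable_fun [set: R] f.
  by apply: measurable_fun_cvg => [n|x _];
    [exact: agree_measurable (af n)|exact: fc].
have bf : exists M, forall x, `|f x| <= M.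
  exists M => x; apply: (cvgr_to_le (cvg_norm (fc x))); exact: nearW.
split => //.
have dct (P : probability R R) :
    (\int[P]_x (f_ n x)%:E)%E @[n --> \oo] --> (\int[P]_x (f x)%:E)%E.
  have [|||||_ _ +] := @dominated_convergence _ _ _ P setT measurableT
    (fun n x => (f_ n x)%:E) (fun x => (f x)%:E) (cst M%:E).
  - by move=> n; apply/measurable_EFinP; exact: agree_measurable (af n).
  - exact/measurable_EFinP.
  - by apply: aeW => x _; apply: cvg_EFin; [exact: nearW|exact: fc].
  - exact: finite_measure_integrable_cst.
  - by apply: aeW => x n _ /=; rewrite lee_fin.
  - by [].
have E : (fun n => \int[mu]_x (f_ n x)%:E)%E = (fun n =>
  \int[nu]_x (f_ n x)%:E)%E.
  by apply/funext => n; exact: agree_integral (af n).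
have := dct mu; rewrite E => /cvg_lim <- //.
by apply: cvg_lim => //; exact: dct.
Qed.

Hypothesis mmu : has_all_moments mu.
Hypothesis mnu : has_all_moments nu.
Hypothesis eq_moment : forall k, moment mu k = moment nu k.
Hypothesis exp_mu : forall t, (\int[mu]_x (expR (t * x))%:E < +oo)%E.

Lemma integral_poly_sum (P : probability R R) (a : nat ->
  R) n : has_all_moments P ->
  (\int[P]_x (\sum_(k < n) a k * x ^+ k)%:E =
    (\sum_(k < n) a k * moment P k)%:E)%E.
Proof.
move=> mP; under eq_integral do rewrite -sumEFin.
rewrite integral_sum // => [|k]; last first.
  by under [X in _.-integrable _ X]eq_fun do rewrite EFinM;
    apply: integrableZl => //; exact: (mP k).
rewrite -sumEFin; apply: eq_bigr => k _.
under eq_integral do rewrite EFinM; rewrite (integralZl measurableT (mP k)).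
by rewrite EFinM /moment unlock fineK //; exact: integrable_fin_num (mP k).
Qed.

(** Only even powers remain, so that the partial sums are nonnegative and
    monotone also for negative y. *)
Lemma cosh_series (y : R) :
  \sum_(k < n) (1 + (-1) ^+ k) / k`!%:R * y ^+ k @[n --> \oo]
    --> expR y + expR (- y).
Proof.
rewrite (_ : (fun n => _) = series (exp_coeff y) \+ series (exp_coeff (- y))).
  by apply: cvgD; exact: is_cvg_series_exp_coeff.
apply/funext => n; rewrite /= /series /= !big_mkord -big_split /=.
by apply: eq_bigr => k _; rewrite /exp_coeff /= [(- y) ^+ k]exprNn; ring.
Qed.

Lemma measurable_expRM (t : R) : measurable_fun [set: R] (fun x =>
  expR (t * x)).
Proof. by apply: measurableT_comp => //; exact: mulrl_measurable. Qed.

Lemma cosh_mu_lty (c : R) :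
  (\int[mu]_x (expR (c * x) + expR (- (c * x)))%:E < +oo)%E.
Proof.
under eq_integral do rewrite EFinD -mulNr.
have -> : (\int[mu]_x ((expR (c * x))%:E + (expR (- c * x))%:E) =
    \int[mu]_x (expR (c * x))%:E + \int[mu]_x (expR (- c * x))%:E)%E.
  apply: ge0_integralD => //; try by move=> x _; rewrite lee_fin expR_ge0.
    by apply/measurable_EFinP; exact: measurable_expRM.
  by apply/measurable_EFinP; exact: measurable_expRM.
apply: lte_add_pinfty; exact: exp_mu.
Qed.

(** By monotone convergence the integral of cosh is a series in the moments,
    hence the same for mu and nu. *)
Lemma cosh_nu_lty (c : R) :
  (\int[nu]_x (expR (c * x) + expR (- (c * x)))%:E < +oo)%E.
Proof.
pose b k : R := (1 + (-1) ^+ k) / k`!%:R * c ^+ k.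
pose S n (x : R) := \sum_(k < n) b k * x ^+ k.
have SE n x : S n x = \sum_(k < n) (1 + (-1) ^+ k) / k`!%:R * (c * x) ^+ k.
  by apply: eq_bigr => k _; rewrite exprMn mulrA.
have Sc x : (S n x)%:E @[n --> \oo] --> (expR (c * x) + expR (- (c * x)))%:E.
  apply: cvg_EFin; first exact: nearW.
  rewrite (_ : _ \o _ = fun n =>
    \sum_(k < n) (1 + (-1) ^+ k) / k`!%:R * (c * x) ^+ k).
    exact: cosh_series.
  by apply/funext => n /=; rewrite SE.
have term_ge0 k (y : R) : 0 <= (1 + (-1) ^+ k) / k`!%:R * y ^+ k.
  rewrite -signr_odd; case/boolP: (odd k) => [_|ek].
    by rewrite expr1 subrr !mul0r.
  rewrite expr0 mulr_ge0 // ?exprn_even_ge0 //.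
have mS n : measurable_fun [set: R] (S n).
  apply: measurable_sum => k; apply: measurable_funM => //;
    exact: exprn_measurable.
have mono (P : probability R R) :
    (\int[P]_x (S n x)%:E)%E @[n --> \oo] -->
    (\int[P]_x (expR (c * x) + expR (- (c * x)))%:E)%E.
  under [X in _ --> X]eq_integral => x _ do rewrite -(cvg_lim _ (Sc x)) //.
  apply: cvg_monotone_convergence => //.
  - by move=> n; apply/measurable_EFinP.
  - by move=> n x _; rewrite lee_fin SE; apply: sumr_ge0 => k _;
    exact: term_ge0.
  - move=> x _ m n mn; rewrite lee_fin !SE.
    rewrite -!(big_mkord xpredT (fun k =>
      (1 + (-1) ^+ k) / k`!%:R * (c * x) ^+ k)).
    rewrite (big_cat_nat (leq0n m) mn) //= lerDl; apply: sumr_ge0 => k _;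
      exact: term_ge0.
have E : (fun n => \int[nu]_x (S n x)%:E)%E = (fun n =>
  \int[mu]_x (S n x)%:E)%E.
  apply/funext => n; rewrite !(integral_poly_sum b) //; congr EFin.
  by apply: eq_bigr => k _; rewrite eq_moment.
have := mono nu; rewrite E => /cvg_lim <- //; rewrite (cvg_lim _ (mono mu)) //.
exact: cosh_mu_lty.
Qed.

(** The partial sums are dominated by exp (c x) + exp (- c x), so that the
    series can be integrated term by term. *)
Lemma series_integral_eq (a : nat -> R) (c : R) (g : R -> R) :
  (forall k, `|a k| <= 1) ->
  (forall x, \sum_(k < n) a k / k`!%:R * x ^+ k @[n --> \oo] --> g x) ->
  (\int[mu]_x (g (c * x))%:E = \int[nu]_x (g (c * x))%:E)%E.
Proof.
move=> a1 ag.
pose b k : R := a k / k`!%:R * c ^+ k.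
pose S n (x : R) := \sum_(k < n) b k * x ^+ k.
have SE n x : S n x = \sum_(k < n) a k / k`!%:R * (c * x) ^+ k.
  by apply: eq_bigr => k _; rewrite exprMn mulrA.
have mS n : measurable_fun [set: R] (S n).
  apply: measurable_sum => k; apply: measurable_funM => //;
    exact: exprn_measurable.
have Sc x : S n x @[n --> \oo] --> g (c * x).
  rewrite (_ : (fun n => _) = fun n =>
    \sum_(k < n) a k / k`!%:R * (c * x) ^+ k) //.
  by apply/funext => n; rewrite SE.
have mg : measurable_fun [set: R] (fun x => g (c * x)).
  by apply: measurable_fun_cvg => [n|x _]; [exact: mS n|exact: Sc].
have bound n x : `|S n x| <= expR (c * x) + expR (- (c * x)).
  rewrite SE; apply: (@le_trans _ _ (expR `|c * x|)).
    apply: (le_trans (ler_norm_sum _ _ _)).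
    apply: (@le_trans _ _ (series (exp_coeff `|c * x|) n)).
      rewrite /series /= big_mkord; apply: ler_sum => k _.
      rewrite normrM normrX normrM normfV normr_nat /exp_coeff /= mulrC
        ler_wpM2l ?exprn_ge0 //.
      by rewrite ler_piMl // invr_ge0.
    apply: nondecreasing_cvgn_le; last exact: is_cvg_series_exp_coeff.
    by apply: nondecreasing_series => k _ _; apply: exp_coeff_ge0.
  by case: (ger0P (c * x)) => _; rewrite ?lerDl ?lerDr expR_ge0.
have dct (P : probability R R) :
    (\int[P]_x (expR (c * x) + expR (- (c * x)))%:E < +oo)%E ->
    (\int[P]_x (S n x)%:E)%E @[n --> \oo] --> (\int[P]_x (g (c * x))%:E)%E.
  move=> fP.
  have [|||||_ _ +] := @dominated_convergence _ _ _ P setT measurableT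
    (fun n x => (S n x)%:E) (fun x => (g (c * x))%:E)
    (fun x => (expR (c * x) + expR (- (c * x)))%:E).
  - by move=> n; apply/measurable_EFinP.
  - exact/measurable_EFinP.
  - by apply: aeW => x _; apply: cvg_EFin; [exact: nearW|exact: Sc].
  - apply/integrableP; split.
      apply/measurable_EFinP; apply: measurable_funD => //.
        exact: measurable_expRM.
      rewrite (_ : (fun x => _) = fun x => expR (- c * x));
        first exact: measurable_expRM.
      by apply/funext => x; rewrite mulNr.
    by under eq_integral do rewrite gee0_abs ?lee_fin ?addr_ge0 ?expR_ge0 //.
  - by apply: aeW => x n _ /=; rewrite lee_fin.
  - by [].
have := dct nu (cosh_nu_lty c).
rewrite (_ : (fun n => _) = fun n => \int[mu]_x (S n x)%:E)%E =>
  [/cvg_lim <- //|].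
  by apply/esym; apply: cvg_lim => //; apply: dct; exact: cosh_mu_lty.
apply/funext => n; rewrite !(integral_poly_sum b) //; congr EFin.
by apply: eq_bigr => k _; rewrite eq_moment.
Qed.

Lemma agree_cosM c : agree (fun x => cos (c * x)).
Proof.
have mcos : measurable_fun [set: R] (fun x : R => cos (c * x)).
  apply: measurableT_comp; last exact: mulrl_measurable.
  by apply: continuous_measurable_fun; exact: continuous_cos.
split=> //; first by exists 1 => x; exact: cos_max.
apply: (@series_integral_eq (fun k => (~~ odd k)%:R * (-1) ^+ k./2) c cos).
  by move=> k; case: odd; rewrite ?mul0r ?normr0 // mul1r normrX normrN1 expr1n.
move=> x; rewrite cos.unlock.
rewrite (_ : (fun n => _) = series (cos_coeff x));
  first exact: is_cvg_series_cos_coeff.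
apply/funext => n; rewrite /series /= big_mkord; apply: eq_bigr => k _.
by rewrite /cos_coeff /= mulrAC.
Qed.

Lemma agree_sinM c : agree (fun x => sin (c * x)).
Proof.
have msin : measurable_fun [set: R] (fun x : R => sin (c * x)).
  apply: measurableT_comp; last exact: mulrl_measurable.
  by apply: continuous_measurable_fun; exact: continuous_sin.
split=> //; first by exists 1 => x; exact: sin_max.
apply: (@series_integral_eq (fun k => (odd k)%:R * (-1) ^+ k.-1./2) c sin).
  by move=> k; case: odd; rewrite ?mul0r ?normr0 // mul1r normrX normrN1 expr1n.
move=> x; rewrite sin.unlock.
rewrite (_ : (fun n => _) = series (sin_coeff x));
  first exact: is_cvg_series_sin_coeff.
apply/funext => n; rewrite /series /= big_mkord; apply: eq_bigr => k _.
by rewrite /sin_coeff /= mulrAC.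
Qed.

(** By induction on n, with the formula turning a product of a sine and a
    cosine into a sum of two cosines. *)
Lemma agree_sinX_cos n s a b c :
  agree (fun x => sin (s * x + a) ^+ n * cos (b * x + c)).
Proof.
elim: n b c => [|n IHn] b c.
  rewrite (_ : (fun x => _) = fun x =>
    cos c * cos (b * x) + (- sin c) * sin (b * x)).
    by apply: agreeD; apply: agreeZ; [exact: agree_cosM|exact: agree_sinM].
  by apply/funext => x; rewrite expr0 mul1r cosD; ring.
have h := agreeD (agreeZ 2^-1 (IHn (s + b) (a + c - pi / 2)))
                 (agreeZ 2^-1 (IHn (s - b) (a - c - pi / 2))).
rewrite (_ : (fun x => _) = fun x =>
    2^-1 * (sin (s * x + a) ^+ n * cos ((s + b) * x + (a + c - pi / 2))) +
    2^-1 * (sin (s * x + a) ^+ n * cos ((s - b) * x + (a - c - pi / 2)))) //.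
apply/funext => x; rewrite -!mulrDr.
have -> : (s + b) * x + (a + c - pi / 2) =
  (s * x + a) + (b * x + c) - pi / 2 by ring.
have -> : (s - b) * x + (a - c - pi / 2) =
  (s * x + a) - (b * x + c) - pi / 2 by ring.
move: (s * x + a) (b * x + c) => u v.
by rewrite !cosBpihalf sinD sinB exprSr; field.
Qed.

Lemma agree_horner_sin (p : {poly R}) s a : agree (fun x =>
  p.[sin (s * x + a)]).
Proof.
pose f i x := p`_i * (sin (s * x + a) ^+ i * cos (0 * x + 0)).
rewrite (_ : (fun x => _) = fun x => \sum_(i < size p) f i x).
  by apply: agree_sum => i; apply: agreeZ; exact: agree_sinX_cos.
apply/funext => x; rewrite horner_coef; apply: eq_bigr => i _.
by rewrite /f mul0r addr0 cos0 mulr1.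
Qed.

(** The indicator is the limit of polynomials in y = (sin + 1) / 2, by
    [peak_cvg]. *)
Lemma agree_sin_lt0 s a : agree (fun x => (sin (s * x + a) < 0)%R%:R).
Proof.
pose y x := (sin (s * x + a) + 1) / 2.
have y01 x : 0 <= y x <= 1.
  have := sin_max (s * x + a); rewrite ler_norml => /andP[h1 h2].
  by rewrite /y; apply/andP; split; lra.
apply: (@agree_lim (fun n x => (1 - y x ^+ n) ^+ (n * 2 ^ n)) _ 1).
- move=> n; pose p : {poly R} := (1 - (2^-1 *: ('X + 1)) ^+ n) ^+ (n * 2 ^ n).
  have := agree_horner_sin p s a; congr agree; apply/funext => x.
  by rewrite /p !hornerE /y [_ / 2]mulrC.
- move=> n x; have /andP[y0 y1] := y01 x.
  have h : 0 <= 1 - y x ^+ n <= 1.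
    by rewrite subr_ge0 exprn_ile1 //= gerBl exprn_ge0.
  have /andP[h0 h1] := h.
  by rewrite ger0_norm ?exprn_ge0 // exprn_ile1.
- move=> x; rewrite (_ : (sin _ < 0) = (y x < 2^-1)); first exact: peak_cvg.
  by apply/idP/idP; rewrite /y; lra.
Qed.

(** The function sin ((x - a) / (n + 1)) has the sign of x - a as soon as n is
    large. *)
Lemma agree_lt a : agree (fun x => (x < a)%R%:R).
Proof.
apply: (@agree_lim (fun n x =>
  (sin (n.+1%:R^-1 * x + - (n.+1%:R^-1 * a)) < 0)%R%:R) _ 1).
- by move=> n; exact: agree_sin_lt0.
- by move=> n x; case: (_ < 0); rewrite ?normr1 ?normr0.
move=> x; apply: cvg_near_cst.
have [N _ NP] : \forall n \near \oo, `|x - a| < n.+1%:R * pi.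
  (* From this rank on, (x - a) / (n + 1) lies in ]- pi, pi[. *)
  exists (Num.bound `|x - a|) => // n /= nb.
  apply: (@lt_le_trans _ _ n.+1%:R).
    by rewrite (lt_le_trans (archi_boundP _)) // ler_nat leqW.
  by rewrite ler_peMr // (le_trans _ (pi_ge2 R)) // ler1n.
exists N => // n /= /NP xn.
have n0 : 0 < n.+1%:R :> R by rewrite ltr0n.
rewrite -mulrBr mulrC; congr (_%:R); congr nat_of_bool.
have [xa|xa|->] := ltgtP x a.
- rewrite -oppr_gt0 -sinN sin_gt0_pi // -mulNr opprB divr_gt0 ?subr_gt0 //=
  ltr_pdivrMr //.
  by rewrite mulrC (le_lt_trans _ xn) // distrC ler_norm.
- apply/negbTE; rewrite -leNgt ltW // sin_gt0_pi // divr_gt0 ?subr_gt0 //=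
  ltr_pdivrMr //.
  by rewrite mulrC (le_lt_trans _ xn) // ler_norm.
- by rewrite subrr mul0r sin0 ltxx.
Qed.

Lemma agree_le a : agree (fun x => (x <= a)%R%:R).
Proof.
apply: (@agree_lim (fun n x => (x < a + n.+1%:R^-1)%R%:R) _ 1).
- by move=> n; exact: agree_lt.
- by move=> n x; case: (_ < _); rewrite ?normr1 ?normr0.
move=> x; apply: cvg_near_cst.
have [xa|ax] := leP x a.
  by apply: nearW => n; rewrite (le_lt_trans xa) // ltrDl invr_gt0.
have xa0 : 0 < x - a by rewrite subr_gt0.
have [N _ NP] := near_infty_natSinv_lt (PosNum xa0).
exists N => // n /= /NP /= h.
have xn : a + n.+1%:R^-1 <= x by rewrite addrC -lerBrDr ltW.
by rewrite ltNge xn.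
Qed.

Theorem moments_determine_measure A : measurable A -> mu A = nu A.
Proof.
move: A; apply: cdf_unique => a.
(* It remains to read the measures of half-lines as integrals. *)
have := agree_integral (agree_le a).
have E (P : probability R R) : (\int[P]_x ((x <=
  a)%R%:R)%:E = P `]-oo, a]%classic)%E.
  rewrite (eq_integral (fun x => (\1_(`]-oo, a]%classic) x)%:E)).
    by rewrite integral_indic // setIT.
  by move=> x _; rewrite indicE mem_setE in_itv.
by rewrite !E.
Qed.

End Agreement.

(** * Convergence of integrals of unbounded functions *)

Section SquareIntegrable.
Variables (R : realType) (f : R -> R) (K : R).
Hypothesis cf : continuous f.

Let mf : measurable_fun [set: R] f.
Proof. exact: continuous_measurable_fun. Qed.

Let mf2 : measurable_fun [set: R] (fun x => f x ^+ 2).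
Proof. by apply: measurable_funX. Qed.

Definition clamp (A y : R) : R := Num.max (- A) (Num.min A y).

Lemma clamp_le A y : 0 < A -> `|clamp A y| <= A.
Proof.
move=> A0; rewrite /clamp ler_norml le_max lexx /= ge_max ge_min lexx /= andbT.
lra.
Qed.

Lemma clamp_error A y : 0 < A -> `|y - clamp A y| <= A^-1 * y ^+ 2.
Proof.
move=> A0; rewrite mulrC ler_pdivlMr //.
have : [\/ clamp A y = y, clamp A y = A /\ A <= y | clamp A y = - A /\ y <=
  - A].
  rewrite /clamp; case/orP: (le_total A y) => hA.
    by rewrite min_l // max_r; [apply: Or32|lra].
  rewrite min_r //; case/orP: (le_total (- A) y) => h.
    by rewrite max_r //; apply: Or31.
  by rewrite max_l //; apply: Or33.
case=> [->|[-> Ay]|[-> Ay]]; first by rewrite subrr normr0 mul0r sqr_ge0.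
  rewrite ger0_norm; nra.
rewrite ler0_norm; nra.
Qed.

Lemma clamp_continuous A : continuous (fun x => clamp A (f x)).
Proof.
move=> x; have h : {for x, continuous ((fun=> A : R^o) \min (f : R -> R^o))}.
  by apply: continuous_min; [exact: cst_continuous|exact: cf].
by apply: (continuous_max _ h); exact: cst_continuous.
Qed.

Lemma square_integrable (P : probability R R) :
  (\int[P]_x (f x ^+ 2)%:E <= K%:E)%E -> P.-integrable [set: R] (EFin \o f).
Proof.
move=> fK.
have i2 : P.-integrable [set: R] (fun x => (1 + f x ^+ 2)%:E).
  apply/integrableP; split.
    by apply/measurable_EFinP; apply: measurable_funD.
  under eq_integral do rewrite gee0_abs ?lee_fin ?addr_ge0 ?sqr_ge0 // EFinD.
  rewrite ge0_integralD //; last 2 first.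
  - by move=> x _; rewrite lee_fin sqr_ge0.
  - exact/measurable_EFinP.
  by rewrite lte_add_pinfty ?(le_lt_trans fK) ?ltry // integral_cst // mul1e
     (le_lt_trans (probability_le1 _ _)) // ltry.
apply: le_integrable i2 => //; first exact/measurable_EFinP.
move=> x _ /=; rewrite lee_fin [X in _ <= X]ger0_norm ?addr_ge0 ?sqr_ge0 //.
by rewrite -(real_normK (num_real (f x))); nra.
Qed.

Lemma clamp_integrable (P : probability R R) A : 0 < A ->
  P.-integrable [set: R] (fun x => (clamp A (f x))%:E).
Proof.
move=> A0; apply: bounded_integrable.
  by apply: continuous_measurable_fun; exact: clamp_continuous.
by exists A => x; exact: clamp_le.
Qed.

Lemma integral_clamp_error (P : probability R R) A : 0 < A ->
  (\int[P]_x (f x ^+ 2)%:E <= K%:E)%E ->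
  `|fine (\int[P]_x (f x)%:E) - fine (\int[P]_x (clamp A (f x))%:E)| <=
    A^-1 * K.
Proof.
move=> A0 fK; have i1 := square_integrable fK; have i2 := clamp_integrable P A0.
have mc : measurable_fun [set: R] (fun x => clamp A (f x)).
  by apply: continuous_measurable_fun; exact: clamp_continuous.
rewrite -lee_fin EFinM.
have -> : (`|fine (\int[P]_x (f x)%:E) - fine (\int[P]_x (clamp A (f
  x))%:E)|%:E =
   `|\int[P]_x ((f x)%:E - (clamp A (f x))%:E)|)%E.
  rewrite integralB //= -(fineK (integrable_fin_num _ i1)) //.
  by rewrite -[in RHS](fineK (integrable_fin_num _ i2)).
apply: (le_trans (le_abse_integral _ _ _)) => //.
  by apply: emeasurable_funB; exact/measurable_EFinP.
apply: (@le_trans _ _ (\int[P]_x (A^-1%:E * (f x ^+ 2)%:E))%E).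
  apply: ge0_le_integral => //.
  - by apply: measurableT_comp => //; apply: emeasurable_funB;
    exact/measurable_EFinP.
  - by apply/measurable_EFinP; apply: measurable_funM.
  - by move=> x _; rewrite -EFinB lee_fin; exact: clamp_error.
rewrite ge0_integralZl //; last 3 first.
- exact/measurable_EFinP.
- by move=> x _; rewrite lee_fin sqr_ge0.
- by rewrite lee_fin invr_ge0 ltW.
by rewrite lee_wpmul2l // lee_fin invr_ge0 ltW.
Qed.

(** Apply weak convergence to the bounded functions min (m, f ^ 2), then
    monotone convergence. *)
Lemma square_integral_limit (nu_ : nat -> probability R R) mu :
  (forall n, (\int[nu_ n]_x (f x ^+ 2)%:E <= K%:E)%E) ->
  cvg_in_distribution nu_ mu -> (\int[mu]_x (f x ^+ 2)%:E <= K%:E)%E.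
Proof.
move=> fK cd.
pose g m x := Num.min m%:R (f x ^+ 2).
have g0 m x : 0 <= g m x by rewrite le_min ler0n sqr_ge0.
have cg m : continuous (g m).
  move=> x; have c2 : {for x, continuous (fun y => f y ^+ 2)}.
    by apply: continuousM; exact: cf.
  by apply: (continuous_min _ c2); exact: cst_continuous.
have gK m : (\int[mu]_x (g m x)%:E <= K%:E)%E.
  apply: (cvge_to_le (cd (g m) (cg m) _)).
    exists m%:R; split; rewrite ?num_real // => y my x _.
    apply: le_trans (ltW my); have -> : `|g m x| = g m x by exact: ger0_norm.
    by rewrite ge_min lexx.
  apply: nearW => n; apply: le_trans (fK n); apply: ge0_le_integral => //.
  - by move=> x _; rewrite lee_fin.
  - by apply/measurable_EFinP; apply: continuous_measurable_fun.
  - exact/measurable_EFinP.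
  - by move=> x _; rewrite lee_fin ge_min lexx orbT.
have gf x : (g m x)%:E @[m --> \oo] --> (f x ^+ 2)%:E.
  apply: cvg_near_cst; exists (Num.bound (f x ^+ 2)) => // m /= bm.
  congr EFin; apply: min_idPr; apply/ltW; apply: lt_le_trans (archi_boundP _) _.
    exact: sqr_ge0.
  by rewrite ler_nat.
under eq_integral => x _ do rewrite -(cvg_lim _ (gf x)) //.
rewrite monotone_convergence //.
- apply: lime_le; last exact: nearW.
  apply: ereal_nondecreasing_is_cvgn => m n mn; apply: ge0_le_integral => //.
  - by move=> x _; rewrite lee_fin.
  - by apply/measurable_EFinP; apply: continuous_measurable_fun.
  - by apply/measurable_EFinP; apply: continuous_measurable_fun.
  - by move=> x _; rewrite lee_fin le_min ge_min ler_nat mn /= ge_min lexx orbT.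
- by move=> m; apply/measurable_EFinP; apply: continuous_measurable_fun.
- by move=> m x _; rewrite lee_fin.
- by move=> x _ m n mn; rewrite lee_fin le_min ge_min ler_nat mn /= ge_min lexx
  orbT.
Qed.

(** Truncating f to [- A, A] makes it bounded and changes its integrals by at
    most K / A, uniformly in n. *)
Theorem cvg_integral_of_square_bound (nu_ : nat -> probability R R) mu :
  (forall n, (\int[nu_ n]_x (f x ^+ 2)%:E <= K%:E)%E) ->
  cvg_in_distribution nu_ mu ->
  mu.-integrable [set: R] (EFin \o f) /\
  (\int[nu_ n]_x (f x)%:E)%E @[n --> \oo] --> (\int[mu]_x (f x)%:E)%E.
Proof.
move=> fK cd; have fKmu := square_integral_limit fK cd.
have imu := square_integrable fKmu; split=> //.
rewrite -(fineK (integrable_fin_num _ imu)) //; apply: cvg_EFin.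
  by apply: nearW => n; apply: integrable_fin_num => //;
    exact: square_integrable (fK n).
have K0 : 0 <= K.
  by rewrite -lee_fin (le_trans _ fKmu) // integral_ge0 // => x _;
    rewrite lee_fin sqr_ge0.
apply/cvgrPdist_lt => e e0.
(* Chosen so that each of the two truncation errors is below e / 3. *)
pose A := 3 * (K + 1) / e.
have A0 : 0 < A by rewrite divr_gt0 // mulr_gt0 // ltr_wpDl.
have AK : A^-1 * K < e / 3.
  rewrite /A invf_div mulrAC ltr_pdivrMr ?mulr_gt0 ?ltr_wpDl //; nra.
have bc : bounded_fun (fun x => clamp A (f x)).
  exists A; split; rewrite ?num_real // => y Ay x _.
  exact: le_trans (clamp_le _ A0) (ltW Ay).
have := cd _ (@clamp_continuous A) bc.
rewrite -[X in _ --> X](fineK (integrable_fin_num _ (clamp_integrable mu A0)))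
  //.
move=> /fine_cvg/cvgrPdist_lt/(_ (e / 3)) h.
have e3 : 0 < e / 3 by rewrite divr_gt0.
near=> n.
have h1 := integral_clamp_error A0 fKmu.
have h2 := integral_clamp_error A0 (fK n).
have h3 : `|fine (\int[mu]_x (clamp A (f x))%:E) -
            fine (\int[nu_ n]_x (clamp A (f x))%:E)| < e / 3.
  by near: n; exact: h.
move: h1 h2 h3; rewrite /=.
move: (fine _) (fine _) (fine _) (fine _) => c d b a h1 h2 h3.
have -> : a - d = (a - b) + (b - c) + (c - d) by ring.
rewrite (le_lt_trans (ler_normD _ _)) // (le_lt_trans (lerD (ler_normD _ _)
  (lexx _))) //.
by rewrite [`|c - d|]distrC; lra.
Unshelve. all: by end_near. Qed.

End SquareIntegrable.

(** * Convergence of the normalized number of inversions *)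

(** Subsequences are only required to satisfy j <= psi j, which suffices for
    limits at infinity. *)
Lemma cvg_subsubsequence (S : topologicalType) (u : nat -> S) (l : S) :
  (forall psi : nat -> nat, (forall j, (j <= psi j)%N) ->
     exists phi : nat -> nat, u (psi (phi j)) @[j --> \oo] --> l) ->
  u n @[n --> \oo] --> l.
Proof.
move=> sub V lV; apply: contrapT => nV.
have pick N : exists n, (N <= n)%N /\ ~ V (u n).
  apply: contrapT => h; apply: nV; exists N => // n /= Nn.
  by apply: contrapT => nVn; apply: h; exists n.
have [psi psiP] := choice pick.
have [phi] := sub psi (fun j => (psiP j).1).
move=> /(_ V lV)[N _ /(_ N (leqnn N))] /=; exact: (psiP _).2.
Qed.

Lemma cvg_geq_infty (psi : nat -> nat) :
  (forall j, (j <= psi j)%N) -> psi @ \oo --> \oo.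
Proof.
move=> psij A [N _ NA]; exists N => // j /= Nj; apply: NA => /=.
exact: leq_trans (psij j).
Qed.

Section ExponentialMoments.
Variables (R : realType) (P : probability R R) (K : R).
Hypothesis expP : forall t : R, `|t| = 1 ->
  (\int[P]_x (expR (t * x))%:E <= K%:E)%E.

(** Up to a factor, even powers are dominated by exp x + exp (- x). *)
Lemma even_power_le (x : R) k : x ^+ k.*2 <=
  k.*2`!%:R * (expR (1 * x) + expR (-1 * x)).
Proof.
rewrite mul1r mulN1r; case: k => [|k].
  by rewrite expr0 mul1r; have := expR_ge1Dx x; have := expR_ge1Dx (- x); lra.
have f0 : 0 < (k.+1).*2`!%:R :> R by rewrite ltr0n fact_gt0.
rewrite mulrC -ler_pdivrMr //.
have : `|x| ^+ k.+1.*2 / (k.+1).*2`!%:R <= expR `|x|.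
  by have := expR_ge1Dxn k.*2.+1 (normr_ge0 x); rewrite doubleS; lra.
rewrite -normrX ger0_norm ?exprn_even_ge0 ?odd_double // => h;
  apply: (le_trans h).
by case: (ger0P x) => _; rewrite ?lerDl ?lerDr expR_ge0.
Qed.

Lemma even_moment_le k :
  (\int[P]_x ((x ^+ k) ^+ 2)%:E <= (k.*2`!%:R * (K + K))%:E)%E.
Proof.
have mx n : measurable_fun [set: R] (fun x : R =>
  x ^+ n) by exact: exprn_measurable.
apply: (@le_trans _ _ (\int[P]_x ((k.*2`!%:R)%:E *
    ((expR (1 * x))%:E + (expR (-1 * x))%:E)))%E).
  apply: ge0_le_integral => //.
  - by move=> x _; rewrite lee_fin sqr_ge0.
  - by apply/measurable_EFinP; apply: measurable_funX.
  - apply: emeasurable_funM => //; apply: emeasurable_funD;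
    apply/measurable_EFinP; exact: measurable_expRM.
  - by move=> x _; rewrite -EFinD -EFinM lee_fin -exprM muln2 even_power_le.
rewrite ge0_integralZl //; last 2 first.
- by apply: emeasurable_funD; apply/measurable_EFinP; exact: measurable_expRM.
- by move=> x _; rewrite -EFinD lee_fin addr_ge0 ?expR_ge0.
rewrite ge0_integralD //; try by move=> x _; rewrite lee_fin expR_ge0.
- rewrite EFinM lee_wpmul2l // EFinD; apply: leeD; apply: expP;
  by rewrite ?normrN normr1.
- by apply/measurable_EFinP; exact: measurable_expRM.
- by apply/measurable_EFinP; exact: measurable_expRM.
Qed.

(** Chebyshev's inequality, the second moment being controlled by the
    exponential ones. *)
Lemma second_moment_tail A e : 0 < A -> K + K <= e / 2 * A ^+ 2 ->
  ((1 - e)%:E <= P `[(- A)%R, A]%classic)%E.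
Proof.
move=> A0 Ke; set C := `[_, _]%classic.
have mC : measurable C by exact: measurable_itv.
have h : ((A ^+ 2)%:E * P (~` C) <= (2 * (K + K))%:E)%E.
  apply: le_trans (even_moment_le 1).
  have -> : P (~` C) = (\int[P]_x (\1_(~` C) x)%:E)%E.
    by rewrite integral_indic ?setIT //; exact: measurableC.
  rewrite -ge0_integralZl //; last 2 first.
  - by apply/measurable_EFinP; apply: measurable_indic; exact: measurableC.
  - by rewrite lee_fin sqr_ge0.
  apply: ge0_le_integral => //.
  - by move=> x _; rewrite mule_ge0 ?lee_fin ?sqr_ge0.
  - apply: emeasurable_funM => //.
    by apply/measurable_EFinP; apply: measurable_indic; exact: measurableC.
  - by apply/measurable_EFinP; apply: measurable_funX; exact: exprn_measurable.
  - move=> x _; rewrite -EFinM lee_fin expr1 indicE.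
    have [|/negP] := boolP (x \in ~` C); last by rewrite mulr0 sqr_ge0.
    rewrite inE /C /= in_itv /= mulr1 => /negP;
      rewrite negb_and -!ltNge => /orP[]; nra.
rewrite probability_setC // in h.
have fP : P C = (fine (P C))%:E by rewrite fineK ?fin_num_measure.
rewrite fP -EFinB -EFinM lee_fin in h; rewrite fP lee_fin.
have : A ^+ 2 * (1 - fine (P C)) <= A ^+ 2 * e by nra.
by rewrite ler_pM2l ?exprn_gt0 //; lra.
Qed.

End ExponentialMoments.

Lemma moment0 (R : realType) (P : probability R R) : moment P 0 = 1.
Proof.
rewrite /moment unlock; under eq_integral do rewrite expr0.
rewrite (integral_cst P measurableT 1%E) mul1e.
have h : fine (P setT) = 1 by rewrite probability_setT.
exact: h.
Qed.

Section InversionLimit.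
Variables (R : realType) (T : nat -> rooted_tree) (zeta : nat -> R).
Hypothesis card_T : forall n, (0 < n)%N -> #|T n| = n.
Hypothesis Upsilon_cvg : forall k, (0 < k)%N ->
  (Upsilon (T n) k.*2)%:R / (Upsilon (T n) 2)%:R ^+ k @[n --> \oo] -->
    zeta k.*2.

Let X n : {RV (uniform_labelling (T n) R) >-> R} :=
  @normalized_inversions (T n) R.
Let nu n : probability R R := distribution (uniform_labelling (T n) R) (X n).

Definition limit_law (mu : probability R R) :=
  has_all_moments mu /\
  forall k, (0 < k)%N ->
    cumulant mu k.*2.-1 = 0 /\
    cumulant mu k.*2 = bernoulli R k.*2 / k.*2%:R * zeta k.*2.

Let kap_ n := inversion_cumulant (T n) (Num.sqrt (Upsilon (T n) 2)%:R : R)^-1.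
Let kap k : R := if odd k then 0 else bernoulli R k / k%:R * zeta k.

Lemma size_over_Upsilon_cvg0 k : (0 < k)%N ->
  #|T n|%:R / (Upsilon (T n) 2)%:R ^+ k @[n --> \oo] --> (0 : R).
Proof.
move=> k0; pose a n := #|T n|%:R / (Upsilon (T n) 2)%:R ^+ k : R.
rewrite -[X in X @ _ --> _]/a -cvg_shiftS.
apply: (squeeze_cvgr _ (cvg_cst (0 : R)) (@cvg_harmonic R)).
apply: nearW => n; apply/andP; split; first by rewrite divr_ge0 ?exprn_ge0.
have U2 : n.+1%:R ^+ 2 <= (Upsilon (T n.+1) 2)%:R :> R.
  by rewrite -natrX ler_nat -{1}(card_T (ltn0Sn n)) Upsilon_ge.
rewrite /a /= card_T // ler_pdivrMr ?exprn_gt0 ?Upsilon2_gt0 // mulrC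
  ler_pdivlMr //.
rewrite -expr2 (le_trans U2) // -[leLHS]expr1 ler_weXn2l //.
by rewrite (le_trans _ U2) // exprn_ege1 // ler1n.
Qed.

(** Odd orders vanish, the first one by centering and the others with the
    Bernoulli numbers; in even order the number of nodes is negligible. *)
Lemma inversion_cumulant_cvg k : (0 < k)%N -> kap_ n k @[n --> \oo] --> kap k.
Proof.
move=> k0; rewrite /kap /kap_ /inversion_cumulant; case: ifP => ok.
  rewrite (_ : (fun n => _) = fun=> 0); first exact: cvg_cst.
  apply/funext => n; case: ifP => // k1.
  have -> : k = k./2.*2.+1 by rewrite -[LHS]odd_double_half ok.
  by rewrite bernoulli_odd ?mul0r //; case: k k0 ok k1 => [|[|[|]]].
have kE : k = k./2.*2 by rewrite -[LHS]odd_double_half ok.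
have h0 : (0 < k./2)%N by rewrite -double_gt0 -kE.
have -> : (k == 1%N) = false by apply: contraFF ok => /eqP ->.
rewrite (_ : (fun n => _) = fun n => bernoulli R k / k%:R *
    ((Upsilon (T n) k)%:R / (Upsilon (T n) 2)%:R ^+ k./2 -
     #|T n|%:R / (Upsilon (T n) 2)%:R ^+ k./2)); last first.
  apply/funext => n; rewrite -mulrA -mulrBl; congr (_ * (_ * _)).
  rewrite exprVn {1}kE -muln2 mulnC exprM sqr_sqrtr //.
apply: cvgMl_tmp; rewrite -[X in _ --> X]subr0; apply: cvgB.
  by rewrite {1 3}kE; exact: Upsilon_cvg.
exact: size_over_Upsilon_cvg0.
Qed.

Lemma nu_mgf_le n t :
  (\int[nu n]_x (expR (t * x))%:E <= (expR (t ^+ 2 / 2))%:E)%E.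
Proof. exact: mgf_normalized_inversions_le. Qed.

Lemma nu_mgf1_le n t : `|t| = 1 ->
  (\int[nu n]_x (expR (t * x))%:E <= (expR 2^-1)%:E)%E.
Proof.
move=> t1; apply: (le_trans (nu_mgf_le n t)).
by rewrite -(real_normK (num_real t)) t1 expr1n div1r.
Qed.

Lemma tight_nu psi : tight (fun j => nu (psi j)).
Proof.
move=> e e0; pose K : R := expR 2^-1 + expR 2^-1.
(* With A = 2 * K / e, the Chebyshev bound needs A <= (A + 1) ^ 2. *)
exists (2 * K / e + 1) => n; apply: (@second_moment_tail _ _ (expR 2^-1)).
- exact: nu_mgf1_le.
- by rewrite ltr_wpDl // divr_ge0 ?(ltW e0) // mulr_ge0 // addr_ge0 ?expR_ge0.
have K0 : 0 < K by rewrite addr_gt0 ?expR_gt0.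
rewrite -/K; set A := 2 * K / e.
have A0 : 0 < A by rewrite !mulr_gt0 ?invr_gt0.
have -> : K = e / 2 * A by rewrite /A; field; rewrite gt_eqF.
by rewrite ler_pM2l ?divr_gt0 //; nra.
Qed.

Lemma moment_cvg psi mu k :
  cvg_in_distribution (fun j => nu (psi j)) mu ->
  mu.-integrable [set: R] (fun x => (x ^+ k)%:E) /\
  moment (nu (psi j)) k @[j --> \oo] --> moment mu k.
Proof.
move=> cmu.
have [|i c] := cvg_integral_of_square_bound _ (fun n =>
  even_moment_le (nu_mgf1_le (psi n)) k) cmu.
  exact: exprn_continuous.
split => //; rewrite /moment unlock; apply: fine_cvg.
by rewrite fineK //; exact: integrable_fin_num.
Qed.

Lemma mgf_cvg psi mu t :
  cvg_in_distribution (fun j => nu (psi j)) mu ->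
  mu.-integrable [set: R] (fun x => (expR (t * x))%:E) /\
  (\int[nu (psi j)]_x (expR (t * x))%:E)%E @[j --> \oo]
    --> (\int[mu]_x (expR (t * x))%:E)%E.
Proof.
(* The square of exp (t x) is exp (2 t x). *)
move=> cmu; apply: (@cvg_integral_of_square_bound _ _ (expR ((t * 2) ^+ 2 /
  2))) cmu.
  by move=> x; apply: continuous_comp;
    [exact: mulrl_continuous|exact: continuous_expR].
move=> n; apply: le_trans (nu_mgf_le _ _);
  under eq_integral do rewrite -expRM_natr mulrAC.
exact: lexx.
Qed.

(** The recursion between moments and cumulants passes to the limit. *)
Lemma limit_law_of_cvg psi mu : (forall j, (j <= psi j)%N) ->
  cvg_in_distribution (fun j => nu (psi j)) mu -> limit_law mu.
Proof.
move=> psij cmu; split=> [k|]; first by have [] := moment_cvg k cmu.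
have rel n : cumulant_rel n (moment mu) kap.
  apply: (@cumulant_rel_cvg _ _ (fun j => moment (nu (psi j))) (fun j =>
    kap_ (psi j))).
  - by move=> k; have [] := moment_cvg k cmu.
  - move=> k k0; apply: (cvg_comp psi (kap_ ^~ k)); first exact: cvg_geq_infty.
    exact: inversion_cumulant_cvg.
  - move=> j.
    rewrite (_ : moment _ = inversion_moment (T (psi j)) (mean_inversions (T
      (psi j)) R)
      (Num.sqrt (Upsilon (T (psi j)) 2)%:R)^-1).
      by apply: inversion_cumulant_rel;
        [rewrite invr_neq0 // gt_eqF // sqrt_Upsilon2_gt0|exact:
          inversion_moment1].
    by apply/funext => k; exact: moment_normalized_inversions.
have cum k : cumulant mu k.+1 = kap k.+1.
  exact: (cumulant_seq_eq (moment0 mu) (rel _)).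
move=> [//|k] _; rewrite doubleS /=; rewrite !cum /kap /= odd_double.
by [].
Qed.

(** Odd and even orders together prescribe all cumulants. *)
Lemma limit_law_unique mu mu' : limit_law mu -> limit_law mu' ->
  (forall t, \int[mu]_x (expR (t * x))%:E < +oo)%E ->
  forall A, measurable A -> mu' A = mu A.
Proof.
move=> [mmu cmu] [mmu' cmu'] fmu A mA; apply/esym.
apply: moments_determine_measure => // k.
apply: cumulants_determine_moments => //.
- exact: moment0.
- exact: moment0.
move=> i; rewrite -[cumulant_seq _ _]/(cumulant mu i.+1) -[RHS]/(cumulant mu'
  i.+1).
have iE := odd_double_half i; case: (odd i) iE => <-; rewrite ?add1n ?add0n.
  have [_ ->] := cmu i./2.+1 isT.
  by have [_ ->] := cmu' i./2.+1 isT.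
have [+ _] := cmu i./2.+1 isT; rewrite doubleS /= => ->.
by have [+ _] := cmu' i./2.+1 isT; rewrite doubleS /= => ->.
Qed.

End InversionLimit.

Theorem theorem1p6 (R : realType) (T : nat -> rooted_tree) (zeta : nat -> R)
    (card_T : forall n, (0 < n)%N -> #|T n| = n)
    (Upsilon_cvg : forall k, (0 < k)%N ->
      (Upsilon (T n) k.*2)%:R / (Upsilon (T n) 2)%:R ^+ k @[n --> \oo]
        --> zeta k.*2) :
  let P n := uniform_labelling (T n) R in
  let X n : {RV (P n) >-> R} := @normalized_inversions (T n) R in
  let is_limit_law (mu : probability R R) :=
    has_all_moments mu /\
    forall k, (0 < k)%N ->
      cumulant mu k.*2.-1 = 0 /\
      cumulant mu k.*2 = bernoulli R k.*2 / k.*2%:R * zeta k.*2 in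
  exists mu : probability R R,
    [/\ is_limit_law mu,
        forall nu : probability R R, is_limit_law nu ->
          forall A, measurable A -> nu A = mu A,
        cvg_in_distribution (fun n => distribution (P n) (X n)) mu
      & forall t : R,
          'M_(P n) (X n) t @[n --> \oo] --> 'M_mu (@idfun R) t /\
          ('M_mu (@idfun R) t < +oo)%E].
Proof.
move=> P X is_limit_law.
have [phi [mu [phij cmu]]] := tight_subsequence (@tight_nu R T id).
have lmu : is_limit_law mu by exact: limit_law_of_cvg phij cmu.
have fmu t : (\int[mu]_x (expR (t * x))%:E < +oo)%E.
  have [imu _] := mgf_cvg t cmu.
  by rewrite -(fineK (integrable_fin_num _ imu)) // ltry.
have uniq nu : is_limit_law nu -> forall A, measurable A -> nu A = mu A.
  by move=> lnu; exact: limit_law_unique lmu lnu fmu.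
have cvg_nu : cvg_in_distribution (fun n => distribution (P n) (X n)) mu.
  move=> f cf bf; apply: cvg_subsubsequence => psi psij.
  have [phi' [mu' [phij' cmu']]] := tight_subsequence (@tight_nu R T psi).
  exists phi'; rewrite (@eq_measure_integral _ _ _ _ mu'); first exact: cmu'.
  move=> A mA _; apply/esym/uniq => //.
  apply: (@limit_law_of_cvg _ _ _ card_T Upsilon_cvg (psi \o phi')) cmu'.
  by move=> j; exact: leq_trans (psij _).
exists mu; split=> // t.
have ME : 'M_mu (@idfun R) t = (\int[mu]_x (expR (t * x))%:E)%E.
  by rewrite /mmt_gen_fun unlock; apply: eq_integral => x _ /=; rewrite mulrC.
rewrite ME; split=> //.
have [_] := mgf_cvg (psi := id) t cvg_nu.
rewrite (_ : (fun n => 'M_(P n) (X n) t) =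
  fun n => (\int[distribution (P n) (X n)]_x (expR (t * x))%:E)%E) //.
apply/funext => n; rewrite integral_distribution.
- by rewrite /mmt_gen_fun unlock; apply: eq_integral => l _ /=; rewrite mulrC.
- by apply/measurable_EFinP; exact: measurable_expRM.
- exact: (integrable_uniform_labelling (fun l => expR (t * X n l))).
Qed.
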